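(* There exist compact sets $E, F \subset \mathbb{C}$ and a holomorphic motion $h:\mathbb{D}\times\widehat{\mathbb{C}}\to\widehat{\mathbb{C}}$ with $h(\lambda,\infty)=\infty$ for all $\lambda\in\mathbb{D}$ such that, writing $E_\lambda:=h(\lambda,E)$ and $F_\lambda:=h(\lambda,F)$ for $\lambda\in\mathbb{D}$, both functions $$\lambda\mapsto\gamma(E_\lambda),\qquad \lambda\mapsto\alpha(F_\lambda)\qquad(\lambda\in\mathbb{D})$$ are discontinuous at $\lambda=0$.
   Context: $\mathbb{D}=\{z\in\mathbb{C}:|z|<1\}$ and $\widehat{\mathbb{C}}=\mathbb{C}\cup\{\infty\}$ is the Riemann sphere. A holomorphic motion of $\widehat{\mathbb{C}}$ is a map $h:\mathbb{D}\times\widehat{\mathbb{C}}\to\widehat{\mathbb{C}}$ such that (i) for each fixed $z\in\widehat{\mathbb{C}}$, the map $\lambda\mapsto h(\lambda,z)$ is holomorphic on $\mathbb{D}$; (ii) for each fixed $\lambda\in\mathbb{D}$, the map $z\mapsto h(\lambda,z)$ is injective on $\widehat{\mathbb{C}}$; (iii) $h(0,z)=z$ for all $z\in\widehat{\mathbb{C}}$. For a set $S$, $h(\lambda,S)=\{h(\lambda,z):z\in S\}$. By the $\lambda$-lemma every holomorphic motion is jointly continuous, so if $h$ fixes $\infty$ and $S\subset\mathbb{C}$ is compact, then $h(\lambda,S)$ is a compact subset of $\mathbb{C}$ for every $\lambda$. For a compact set $S\subset\mathbb{C}$, put $D=\widehat{\mathbb{C}}\setminus S$ (an open set containing $\infty$,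 not necessarily connected). $H^\infty(D)$ is the space of bounded analytic functions on $D$, and $A(D)$ is the subspace consisting of the continuous functions $\widehat{\mathbb{C}}\to\mathbb{C}$ that are analytic on $D$. For $f$ analytic near $\infty$, $f'(\infty):=\lim_{z\to\infty}z(f(z)-f(\infty))$. The analytic capacity of $S$ is $$\gamma(S):=\sup\{|f'(\infty)|: f\in H^\infty(D),\ |f|\le 1\text{ on }D\},$$ and the continuous analytic capacity of $S$ is $$\alpha(S):=\sup\{|g'(\infty)|: g\in A(D),\ |g|\le 1\text{ on }\mathbb{C}\}.$$ *)

(* Defs.v *)
From HB Require Import structures.
From mathcomp Require Import all_boot all_order all_algebra.
From mathcomp Require Import complex.
From mathcomp Require Import all_classical all_reals all_analysis.

Set Implicit Arguments.
Unset Strict Implicit.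
Unset Printing Implicit Defensive.

Import Order.TTheory GRing.Theory Num.Theory.
Import numFieldNormedType.Exports.

Local Open Scope classical_set_scope.
Local Open Scope ring_scope.

(* [R[i]] has no topology of its own in the library; its regular module [R[i]^o]
   carries the norm topology, and [derivable f z 1] for f : C R -> C R is then
   complex differentiability at z. *)
Notation C R := ((complex R)^o) (only parsing).

Notation sphere R := (one_point_compactification (C R)) (only parsing).

Notation infty := (@None _) (only parsing).

Section definitions.
Variable R : realType.

Definition unit_disc : set (C R) := [set z | `|z| < 1].

Definition sphere_inv (w : sphere R) : sphere R :=
  if w is Some z then (if z == 0 then infty else Some z^-1) else Some 0.

(* The value at infinity is a dummy. *)
Definition affine (w : sphere R) : C R := if w is Some z then z else 0.

Definition chart_at (w0 : sphere R) : sphere R -> C R :=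
  if w0 is Some _ then affine else affine \o sphere_inv.

Definition param_at (w0 : sphere R) : C R -> sphere R :=
  if w0 is Some _ then Some else sphere_inv \o Some.

(* Continuity keeps f l inside the domain of the chart for l near l0, so that
   the dummy value of [affine] is never seen by the derivative. *)
Definition sphere_holomorphic_at (f : C R -> sphere R) (l0 : C R) : Prop :=
  {for l0, continuous f} /\ derivable (chart_at (f l0) \o f) l0 1.

Definition analytic_at (f : sphere R -> C R) (w : sphere R) : Prop :=
  derivable (f \o param_at w) (chart_at w w) 1.

(* For open D this is analyticity on D; the values of f outside D are
   irrelevant. *)
Definition analytic_on (D : set (sphere R)) (f : sphere R -> C R) : Prop :=
  forall w, D w -> analytic_at f w.

(* Motions are total functions, constrained only for l in the unit disc. *)
Record holomorphic_motion (h : C R -> sphere R -> sphere R) : Prop := {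
  motion_holomorphic : forall (w : sphere R) (l : C R),
    unit_disc l -> sphere_holomorphic_at (h ^~ w) l ;
  motion_injective : forall l : C R, unit_disc l -> injective (h l) ;
  motion_base : forall w : sphere R, h 0 w = w }.

(* h(l, S) as a subset of the plane; no point is lost when h l is injective and
   fixes infinity. *)
Definition motion_image (h : C R -> sphere R -> sphere R) (l : C R)
    (S : set (C R)) : set (C R) :=
  Some @^-1` (h l @` (Some @` S)).

Definition sphere_compl (S : set (C R)) : set (sphere R) := ~` (Some @` S).

Definition Hinfty (D : set (sphere R)) : set (sphere R -> C R) :=
  [set f | analytic_on D f /\
           exists M : C R, forall w, D w -> `|f w| <= M].

Definition Aspace (D : set (sphere R)) : set (sphere R -> C R) :=
  [set g | continuous g /\ analytic_on D g].

Definition deriv_infty (f : sphere R -> C R) : C R :=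
  lim ((fun w : sphere R => affine w * (f w - f infty))
         @ (infty : sphere R)^').

(* [`|z|] has type R[i], hence the real part. The supremum is taken in \bar R,
   where it exists without a boundedness side condition. *)
Definition analytic_capacity (S : set (C R)) : \bar R :=
  ereal_sup [set (complex.Re `|deriv_infty f|)%:E | f in
    [set f | Hinfty (sphere_compl S) f /\
             forall w, sphere_compl S w -> `|f w| <= 1]].

Definition continuous_analytic_capacity (S : set (C R)) : \bar R :=
  ereal_sup [set (complex.Re `|deriv_infty g|)%:E | g in
    [set g | Aspace (sphere_compl S) g /\
             forall z : C R, `|g (Some z)| <= 1]].

End definitions.

(* Main.v *)
Require Import Defs.
From mathcomp Require Import all_boot all_order all_algebra.
From mathcomp Require Import complex.
From mathcomp Require Import all_classical all_reals all_analysis.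
From mathcomp Require Import ring lra.
Import Order.TTheory GRing.Theory Num.Theory.
Import numFieldNormedType.Exports.
Import Normc.
Set Implicit Arguments.
Unset Strict Implicit.
Unset Printing Implicit Defensive.
Local Open Scope classical_set_scope.
Local Open Scope ring_scope.
Local Open Scope complex_scope.

(** One compact set and one motion serve for both capacities.

    The set [cantor_dust] is a planar four-corner Cantor set: its generation n
    consists of 4^n discs of radius l_n with 4^n l_n = ((n + 11) / 11)^2. Its
    dimension is 1, so it is at the edge of removability, but the numbers
    1 / (4^n l_n) have a finite sum. Hence the approximations to the Cauchy
    transform of its natural probability measure, whose successive differences
    are dominated by these numbers ([approx_pot_diff]), converge uniformly. The
    limit is bounded, continuous on the sphere, holomorphic off the set, and
    behaves like 1/z at infinity. After division by a bound it is a competitor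
    ([witness]) that makes both capacities positive at l = 0.

    The motion multiplies all contraction ratios of the Cantor set by
    a = 1 + l/5. For l = -t with 0 < t < 1 the total size 4^n l_n a^n tends
    to 0. If f is bounded and holomorphic off the moved set, Cauchy's theorem
    replaces the integral of f over a large square by 4^n integrals over small
    squares, which are dominated by this total size; so f'(infinity) = 0
    ([covered_deriv_infty]). A competitor for the continuous capacity is of
    this kind too, so both capacities vanish at the parameters -t, which tend
    to 0. Cauchy's theorem for rectangles is proved by Goursat's bisection
    ([goursat]), since holomorphy here is mere pointwise differentiability.

    The motion must be defined on the whole sphere. The vector field [drift] is
    1-Lipschitz, supported in the four discs of radius 2/5 about the corners,
    and equal to (z - c)/5 on the discs of radius 3/10. So z + l drift(z) is
    injective for |l| < 1, is affine in l, and dilates each inner disc by the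
    factor a. The same map is inserted, rescaled, in the first-generation
    discs, and so on. The resulting infinite composition is a power series,
      z + l (sum over k of a^k l_k drift(z_k)),
    where z_k is z as seen from the generation-k disc that contains it. This
    formula gives holomorphy in l ([transport_cdiff]); injectivity follows by
    zooming in until the two points are separated ([transport_inj]). *)

(** * The real-valued norm of a complex number *)

Section ComplexNorm.
Variable R : realType.
Implicit Types (z w : R[i]) (x y e : R).

Lemma normrcE z : `|z| = (normc z)%:C.
Proof. by case: z. Qed.

Lemma Re_normr z : complex.Re `|z| = normc z.
Proof. by rewrite normrcE. Qed.

Lemma normc_ge0 z : 0 <= normc z.
Proof. by case: z => a b; exact: sqrtr_ge0. Qed.

Lemma normcR x : normc x%:C = `|x|.
Proof. by rewrite /normc /= expr0n addr0 sqrtr_sqr. Qed.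

Lemma normc_triangle z w : normc (z + w) <= normc z + normc w.
Proof. exact: le_normcD. Qed.

Lemma normc_opp z : normc (- z) = normc z.
Proof. exact: normcN. Qed.

Lemma normcB z w : normc (z - w) = normc (w - z).
Proof. by rewrite -normc_opp opprB. Qed.

Lemma normc_distl z w : normc z - normc w <= normc (z - w).
Proof. by rewrite lerBlDr -{1}(subrK w z) normc_triangle. Qed.

Lemma normc_sub z w : normc (z - w) <= normc z + normc w.
Proof. by rewrite -(normc_opp w) normc_triangle. Qed.

Lemma normc_eq0 z : (normc z == 0) = (z == 0).
Proof.
apply/eqP/eqP => [/eq0_normc //|->]; exact: normc0.
Qed.

Lemma normc_gt0 z : (0 < normc z) = (z != 0).
Proof. by rewrite lt_def normc_ge0 andbT normc_eq0. Qed.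

Lemma normcX z n : normc (z ^+ n) = normc z ^+ n.
Proof.
by elim: n => [|n IH]; rewrite ?expr0 ?normc1 // !exprS normcM IH.
Qed.

Lemma normr_Re z : `|complex.Re z| <= normc z.
Proof. by rewrite -lecR -normrcE normc_ge_Re. Qed.

Lemma normr_Im z : `|complex.Im z| <= normc z.
Proof.
case: z => a b /=; rewrite -[leLHS]sqrtr_sqr ler_wsqrtr // lerDr; exact: sqr_ge0.
Qed.

Lemma normc_sqr z : normc z ^+ 2 = complex.Re z ^+ 2 + complex.Im z ^+ 2.
Proof. by case: z => a b /=; rewrite sqr_sqrtr // addr_ge0 ?sqr_ge0. Qed.

Lemma normc_ReIm z : normc z <= `|complex.Re z| + `|complex.Im z|.
Proof.
rewrite -(@ler_pXn2r _ 2) ?nnegrE ?normc_ge0 ?addr_ge0 //.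
rewrite normc_sqr -(real_normK (num_real (complex.Re z))).
rewrite -(real_normK (num_real (complex.Im z))).
have := normr_ge0 (complex.Re z); have := normr_ge0 (complex.Im z).
move: `|_| `|_| => p q; nra.
Qed.

Lemma nbhs_normc (z : C R) (A : set (C R)) :
  nbhs z A <-> exists2 e : R, 0 < e & forall w : C R, normc (w - z) < e -> A w.
Proof.
rewrite -nbhs_ballE; split.
- case=> e /= e0 H; exists (complex.Re e).
    by move: e0; rewrite ltcE => /andP[].
  move=> w wz; apply: H; rewrite -ball_normE /= -opprB normrN normrcE.
  by move: e0; case: e wz => a b /= wz; rewrite !ltcE /= => /andP[/eqP -> _]; rewrite eqxx.
- case=> e e0 H; exists e%:C; first by rewrite /= ltcR.
  by move=> w; rewrite -ball_normE /= -opprB normrN normrcE ltcR => /H.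
Qed.

Lemma cvg_normc (T : Type) (F : set_system T) (f : T -> C R) (l : C R) :
  Filter F ->
  (f @ F --> l) <-> forall e : R, 0 < e -> \forall t \near F, normc (f t - l) < e.
Proof.
move=> FF; split.
- move=> fl e e0.
  have /fl : nbhs l [set w | normc (w - l) < e] by apply/nbhs_normc; exists e.
  by [].
- move=> H A /nbhs_normc [e e0 HA]; rewrite /nbhs /=.
  by apply: filterS (H e e0) => t; exact: HA.
Qed.

(** Differentiability in the form of a first-order expansion with real error
    bounds: it avoids difference quotients and the order on complex numbers. *)
Definition cdiff_to (f : R[i] -> R[i]) z (d : R[i]) :=
  forall e : R, 0 < e -> exists2 del : R, 0 < del &
    forall w, normc (w - z) < del ->
      normc (f w - f z - (w - z) * d) <= e * normc (w - z).

Definition cdiff f z := exists d, cdiff_to f z d.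

Lemma cdiff_toP (f : C R -> C R) (z d : C R) :
  ((fun h : C R => h^-1 *: (f (h *: (1 : C R) + z) - f z)) @ (0 : C R)^' --> d)
  <-> cdiff_to f z d.
Proof.
split.
- move/(cvg_normc _ _ (dnbhs_filter _)) => H e e0.
  have /nbhs_normc [del del0 Hdel] := H e e0.
  exists del => // w wz; have [->|nwz] := eqVneq w z.
    by rewrite !subrr mul0r subrr normc0 mulr0.
  have n0 : w - z != 0 by rewrite subr_eq0.
  have := Hdel (w - z); rewrite subr0 => /(_ wz n0).
  have -> : ((w - z : C R) *: (1 : C R) + z) = w.
    by rewrite /GRing.scale /= mulr1 subrK.
  move/ltW => Hn; rewrite -(ler_pM2l (_ : 0 < (normc (w - z))^-1)); last first.
    by rewrite invr_gt0 normc_gt0.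
  rewrite mulrCA mulVf ?mulr1 ?normc_eq0 // -normcV -normcM.
  by rewrite mulrBr mulrA mulVf ?mul1r.
- move=> H; apply/(cvg_normc _ _ (dnbhs_filter _)) => e e0.
  have e20 : 0 < e / 2 by rewrite divr_gt0.
  have [del del0 Hdel] := H _ e20.
  apply/nbhs_normc; exists del => // h; rewrite subr0 => hd h0.
  have := Hdel (h + z); rewrite addrK => /(_ hd) Hh.
  have -> : h *: (1 : C R) + z = h + z by rewrite /GRing.scale /= mulr1.
  apply: le_lt_trans (_ : e / 2 < e); last by rewrite ltr_pdivrMr // mulr_natr mulr2n ltrDl.
  rewrite -(ler_pM2r (_ : 0 < normc h)) ?normc_gt0 //.
  apply: le_trans Hh; rewrite -normcM mulrC /GRing.scale /= mulrBr mulrA mulfV //.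
  by rewrite mul1r.
Qed.

Lemma derivable_cdiff (f : C R -> C R) (z : C R) : derivable f z 1 <-> cdiff f z.
Proof.
split.
- by move=> H; exists (lim ((fun h : C R => h^-1 *: (f (h *: (1 : C R) + z) - f z)) @ (0 : C R)^')); apply/cdiff_toP.
- by case=> d /cdiff_toP H; apply/cvg_ex; exists d.
Qed.

End ComplexNorm.

(** * Neighbourhoods of infinity on the sphere *)

Section Sphere.
Variable R : realType.
Implicit Types (z w : R[i]) (x y e : R).

Lemma closed_normc_ball (c : R[i]) (M : R) :
  closed ([set z | normc (z - c) <= M] : set (C R)).
Proof.
rewrite -[X in closed X]setCK; apply: open_closedC; rewrite openE => z /= /negP.
rewrite -ltNge => zM; apply/nbhs_normc.
exists (normc (z - c) - M); first by rewrite subr_gt0.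
move=> w wz /=; apply/negP; rewrite -ltNge.
have := normc_triangle (z - w) (w - c); rewrite addrA subrK (normcB z w) => H.
by move: wz; lra.
Qed.

Lemma closed_normc_ball0 (M : R) : closed ([set z | normc z <= M] : set (C R)).
Proof.
by have := @closed_normc_ball 0 M; under eq_set do rewrite subr0.
Qed.

Lemma compact_normc_ball (M : R) : compact ([set z | normc z <= M] : set (C R)).
Proof.
pose f (p : R * R) : C R := p.1 +i* p.2.
have cf : continuous f.
  move=> p; apply/cvg_normc => e e0.
  have e2 : 0 < e / 2 by rewrite divr_gt0.
  have h1 : (fun q : R * R => q.1) @ p --> p.1 by exact: cvg_fst.
  have h2 : (fun q : R * R => q.2) @ p --> p.2 by exact: cvg_snd.
  move/cvgrPdist_lt: h1 => /(_ _ e2) h1; move/cvgrPdist_lt: h2 => /(_ _ e2) h2.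
  near=> q; apply: le_lt_trans (normc_ReIm _) _ => /=.
  rewrite (distrC q.1) (distrC q.2).
  have : `|p.1 - q.1| < e / 2 by near: q.
  have : `|p.2 - q.2| < e / 2 by near: q.
  lra.
have := continuous_compact (continuous_subspaceT cf)
  (compact_setX (segment_compact (a := - M) (b := M)) (segment_compact (a := - M) (b := M))).
move/(subclosed_compact _); apply.
  exact: closed_normc_ball0.
case=> a b ab; exists (a, b) => //; split; rewrite /= in_itv /= -ler_norml.
  exact: le_trans (normr_Re (a +i* b)) ab.
exact: le_trans (normr_Im (a +i* b)) ab.
Unshelve. all: by end_near. Qed.

Lemma analytic_at_Some (f : sphere R -> C R) (z : C R) :
  analytic_at f (Some z) <-> cdiff (fun w => f (Some w)) z.
Proof. exact: derivable_cdiff. Qed.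

Lemma analytic_at_infty (f : sphere R -> C R) :
  analytic_at f infty <-> cdiff (fun w => f (sphere_inv (Some w))) 0.
Proof. exact: derivable_cdiff. Qed.

(** Discs are compact, so their complements are neighbourhoods of infinity. *)
Lemma near_infty (A : set (sphere R)) (M : R) :
  (forall z, M < normc z -> A (Some z)) -> \forall w \near (infty : sphere R)^', A w.
Proof.
move=> H; exists [set z | normc z <= M].
  split; first exact: compact_normc_ball.
  exact: closed_normc_ball0.
move=> w [|->]; last by move=> /eqP.
by move=> [z /= /negP]; rewrite -ltNge => zM <- _; exact: H.
Qed.

Lemma continuous_Re : continuous (@complex.Re R : C R -> R).
Proof.
move=> z; apply/(cvgrPdist_lt (FF := nbhs_filter z)) => e e0; apply/nbhs_normc; exists e => // w wz.
rewrite distrC; apply: le_lt_trans wz; have := normr_Re (w - z).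
by rewrite raddfB.
Qed.

(** The plane is not compact: the real part is unbounded on it. Without this
    the limit that defines [deriv_infty] would be arbitrary. *)
Lemma dnbhs_infty_proper : ProperFilter (infty : sphere R)^'.
Proof.
apply: Build_ProperFilter_ex => A [K [cK _] KA].
have := continuous_compact (continuous_subspaceT continuous_Re) cK.
move/compact_bounded => [M [_ HM]].
have nK : ~ K (`|M| + 2)%:C.
  have h : M < `|M| + 1 by have := ler_norm M; lra.
  move=> Kx; have := HM _ h _ (imageP _ Kx) => /=.
  have n0 := normr_ge0 M.
  rewrite ger0_norm; lra.
exists (Some (`|M| + 2)%:C); apply: KA => //; left; exists (`|M| + 2)%:C => //.
Qed.

Lemma deriv_infty_eq (f : sphere R -> C R) (d : C R) :
  (forall e, 0 < e -> exists M : R, forall z, M < normc z ->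
     normc (z * (f (Some z) - f infty) - d) <= e) -> deriv_infty f = d.
Proof.
have FF := dnbhs_infty_proper.
move=> H; apply: (@cvg_lim (C R) _ (sphere R) _ FF); first exact: norm_hausdorff.
apply/(cvg_normc _ _ (dnbhs_filter _)) => e e0.
have e20 : 0 < e / 2 by rewrite divr_gt0.
have [M HM] := H _ e20; apply: (near_infty (M := M)) => z /HM /= zM.
by apply: le_lt_trans zM _; rewrite ltr_pdivrMr // mulr_natr mulr2n ltrDl.
Qed.

(** Analyticity at infinity is the expansion f(z) = f(infinity) + d/z + o(1/z);
    this lemma and [expansion_analytic_infty] pass between z and 1/z. *)
Lemma analytic_infty_expansion (f : sphere R -> C R) :
  analytic_at f infty -> exists d : C R,
  forall e, 0 < e -> exists M : R, forall z, M < normc z ->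
     normc (z * (f (Some z) - f infty) - d) <= e.
Proof.
move/analytic_at_infty => [d Hd]; exists d => e e0.
have [del del0 H] := Hd e e0; exists del^-1 => z zM.
have z0 : 0 < normc z by apply: lt_trans zM; rewrite invr_gt0.
have zn0 : z != 0 by rewrite -normc_gt0.
have := H z^-1; rewrite !subr0 normcV => Hz.
have : (normc z)^-1 < del by rewrite -(invrK del) ltf_pV2 // posrE invr_gt0.
move/Hz; rewrite /= eqxx invr_eq0 (negbTE zn0) invrK => {}Hz.
rewrite -(ler_pM2r (_ : 0 < (normc z)^-1)) ?invr_gt0 //.
apply: le_trans Hz; rewrite -normcV -normcM.
by rewrite le_eqVlt; apply/orP; left; apply/eqP; congr normc; field.
Qed.

Lemma expansion_analytic_infty (f : sphere R -> C R) (d : C R) :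
  (forall e, 0 < e -> exists M : R, forall z, M < normc z ->
     normc (z * (f (Some z) - f infty) - d) <= e) -> analytic_at f infty.
Proof.
move=> H; apply/analytic_at_infty; exists d => e e0.
have [M HM] := H e e0; pose M' := Num.max M 1.
have M'0 : 0 < M' by rewrite /M' lt_max ltr01 orbT.
exists M'^-1; first by rewrite invr_gt0.
move=> w; rewrite !subr0 /= eqxx; have [->|w0] := eqVneq w 0.
  by rewrite subrr mul0r subrr normc0 mulr0.
have w0' : 0 < normc w by rewrite normc_gt0.
move=> wM; have : M < normc w^-1.
  apply: (@le_lt_trans _ _ M'); first by rewrite /M' le_max lexx.
  by rewrite normcV -(invrK M') ltf_pV2 // posrE invr_gt0.
move/HM; rewrite -(ler_pM2r w0'); apply: le_trans.
rewrite -normcM.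
by rewrite le_eqVlt; apply/orP; left; apply/eqP; congr normc; field.
Qed.

Lemma continuous_sphere (f : sphere R -> C R) :
  (forall (z : C R) e, 0 < e -> exists2 del : R, 0 < del & forall w, normc (w - z) < del ->
     normc (f (Some w) - f (Some z)) <= e) ->
  (forall e, 0 < e -> exists M : R, forall z, M < normc z ->
     normc (f (Some z) - f infty) <= e) ->
  continuous f.
Proof.
move=> H1 H2 w; apply/(cvg_normc _ _ (nbhs_filter w)) => e e0.
have e20 : 0 < e / 2 by rewrite divr_gt0.
case: w => [z|].
  have [del del0 H] := H1 z _ e20; apply/nbhs_normc; exists del => // w /H /= wz.
  by apply: le_lt_trans wz _; lra.
have [M HM] := H2 _ e20.
exists [set z | normc z <= M].
  by split; [exact: compact_normc_ball|exact: closed_normc_ball0].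
move=> w [|->]; last by rewrite /= subrr normc0.
move=> [z /= /negP]; rewrite -ltNge => zM <- /=.
by apply: le_lt_trans (HM _ zM) _; lra.
Qed.

End Sphere.

(** * Integrals of continuous functions over segments *)

Section RealIntegral.
Variable R : realType.
Local Notation mu := (@lebesgue_measure R).
Implicit Types (g h : R -> R) (a b c : R).

(** Two-sided continuity at every point of the segment, including its ends; it
    is what differentiability on a closed rectangle provides. *)
Definition cont_seg g a b := forall t, a <= t <= b -> {for t, continuous g}.

Definition segint g a b : R := \int[mu]_(x in `[a, b]) g x.

Lemma cont_seg_sub g a b c d : a <= c -> d <= b -> cont_seg g a b -> cont_seg g c d.
Proof. by move=> ac db H t /andP[ct td]; apply: H; lra. Qed.

Lemma cont_seg_integrable g a b :
  cont_seg g a b -> mu.-integrable `[a, b] (EFin \o g).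
Proof.
move=> H; apply: continuous_compact_integrable; first exact: segment_compact.
apply: continuous_in_subspaceT => x; rewrite inE /= in_itv /= => xab; exact: H.
Qed.

Lemma segint_cat g a b c : a <= b -> b <= c -> cont_seg g a c ->
  segint g a c = segint g a b + segint g b c.
Proof.
move=> ab bc H; rewrite /segint.
have := @Rintegral_itvB R g (BLeft a) (BRight c) b (cont_seg_integrable H).
rewrite !bnd_simp ab bc => /(_ isT isT).
rewrite Rintegral_itv_obnd_cbnd; last first.
  have Hbc : mu.-integrable `[b, c] (EFin \o g).
    by apply: cont_seg_integrable; apply: cont_seg_sub H.
  apply: integrableS Hbc => //.
  by apply: subset_itv; rewrite bnd_simp.
by move<-; rewrite addrC subrK.
Qed.

Lemma segintD g h a b : cont_seg g a b -> cont_seg h a b ->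
  segint (fun t => g t + h t) a b = segint g a b + segint h a b.
Proof.
by move=> Hg Hh; rewrite /segint RintegralD //; exact: cont_seg_integrable.
Qed.

Lemma segintZ k g a b : cont_seg g a b -> segint (fun t => k * g t) a b = k * segint g a b.
Proof.
by move=> Hg; rewrite /segint RintegralZl //; exact: cont_seg_integrable.
Qed.

Lemma segint_cst k a b : a <= b -> segint (fun=> k) a b = k * (b - a).
Proof.
move=> ab; rewrite /segint Rintegral_cst //= lebesgue_measure_itv /= lte_fin.
case: ltP => //= ba.
have -> : b = a by apply/eqP; rewrite eq_le ab ba.
by rewrite subrr.
Qed.

Lemma segint_le g h a b : cont_seg g a b -> cont_seg h a b ->
  (forall t, a <= t <= b -> g t <= h t) -> segint g a b <= segint h a b.
Proof.
move=> Hg Hh gh; apply: le_Rintegral => //; try exact: cont_seg_integrable.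
Qed.

Lemma cont_seg_cst k a b : cont_seg (fun=> k) a b.
Proof. by move=> t _; exact: cvg_cst. Qed.

Lemma segint_bound g a b M : a <= b -> cont_seg g a b ->
  (forall t, a <= t <= b -> `|g t| <= M) -> `|segint g a b| <= M * (b - a).
Proof.
move=> ab Hg gM; rewrite ler_norml; apply/andP; split.
  rewrite -mulNr -segint_cst //; apply: segint_le => //; first exact: cont_seg_cst.
  by move=> t /gM; rewrite ler_norml => /andP[].
rewrite -segint_cst //; apply: segint_le => //; first exact: cont_seg_cst.
by move=> t /gM; rewrite ler_norml => /andP[].
Qed.

Lemma eq_segint g h a b : (forall t, a <= t <= b -> g t = h t) -> segint g a b = segint h a b.
Proof. by move=> gh; apply: eq_Rintegral => t; rewrite inE /= in_itv /= => /gh. Qed.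

Lemma segint_id a b : a <= b -> segint id a b = (b ^+ 2 - a ^+ 2) / 2.
Proof.
rewrite le_eqVlt => /orP[/eqP <-|ab].
  by rewrite subrr mul0r /segint set_itv1 Rintegral_set1.
have dF (x : R) : is_derive x 1 (fun t : R => t ^+ 2 / 2) x.
  apply: is_derive_eq. rewrite /GRing.scale /= !mulr0 !add0r mulr1 -mulr2n -[X in _ * X]mulr_natl mulKf ?pnatr_eq0 //.
have cF (x : R) : {for x, continuous (fun t : R => t ^+ 2 / 2)}.
  apply: differentiable_continuous; apply/derivable1_diffP; by case: (dF x).
rewrite /segint /Rintegral (@continuous_FTC2 _ _ (fun t => t ^+ 2 / 2)) //=.
- by rewrite mulrBl.
- by apply: continuous_subspaceT => x; exact: cvg_id.
- split.
  + by move=> x _; case: (dF x).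
  + by apply: cvg_at_right_filter; exact: cF.
  + by apply: cvg_at_left_filter; exact: cF.
- by move=> x _; rewrite derive1E; case: (dF x).
Qed.

End RealIntegral.

(** * Contour integrals over boundaries of rectangles *)

Section BoxIntegral.
Variable R : realType.
Implicit Types (F G : R -> R[i]) (f g : R[i] -> R[i]) (a b c : R) (z : R[i]).

Definition ccont F a b :=
  cont_seg (fun t => complex.Re (F t)) a b /\ cont_seg (fun t => complex.Im (F t)) a b.

Definition csegint F a b : R[i] :=
  segint (fun t => complex.Re (F t)) a b +i* segint (fun t => complex.Im (F t)) a b.

Lemma csegint_cat F a b c : a <= b -> b <= c -> ccont F a c ->
  csegint F a c = csegint F a b + csegint F b c.
Proof. by move=> ab bc [H1 H2]; rewrite /csegint (segint_cat ab bc H1) (segint_cat ab bc H2). Qed.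

Lemma csegintD F G a b : ccont F a b -> ccont G a b ->
  csegint (fun t => F t + G t) a b = csegint F a b + csegint G a b.
Proof.
move=> [F1 F2] [G1 G2]; rewrite /csegint; simpc; rewrite -!segintD //.
by congr (_ +i* _); apply: eq_segint => t _; case: (F t) => ? ?; case: (G t).
Qed.

Lemma cont_segZ k (g : R -> R) a b : cont_seg g a b ->
  cont_seg (fun t => k * g t) a b.
Proof. by move=> Hg t tab; apply: cvgMr; exact: Hg. Qed.

Lemma csegintZ k F a b : ccont F a b -> csegint (fun t => k * F t) a b = k * csegint F a b.
Proof.
move=> [F1 F2]; case: k => p q; rewrite /csegint; simpc.
rewrite -[- (_ * _)]mulNr -!segintZ //.
rewrite -!segintD; try exact: cont_segZ.
by congr (_ +i* _); apply: eq_segint => t _; case: (F t) => u v /=; rewrite ?mulNr.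
Qed.

(** The factor 2 comes from bounding the real and imaginary parts separately;
    no sharp constant is needed later. *)
Lemma csegint_bound F a b M : a <= b -> ccont F a b ->
  (forall t, a <= t <= b -> normc (F t) <= M) -> normc (csegint F a b) <= 2 * M * (b - a).
Proof.
move=> ab [F1 F2] FM; apply: le_trans (normc_ReIm _) _ => /=.
have h1 := segint_bound ab F1 (fun t H => le_trans (normr_Re (F t)) (FM t H)).
have h2 := segint_bound ab F2 (fun t H => le_trans (normr_Im (F t)) (FM t H)).
lra.
Qed.

(** Continuity at [z], with real error bounds as in [cdiff_to]. *)
Definition fcont f z := forall e : R, 0 < e -> exists2 del : R, 0 < del &
  forall w, normc (w - z) < del -> normc (f w - f z) <= e.

Lemma cdiff_fcont f z : cdiff f z -> fcont f z.
Proof.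
move=> [d Hd] e e0; have [del del0 H] := Hd 1 ltr01.
pose K := 1 + normc d; have K0 : 0 < K by rewrite /K; have := normc_ge0 d; lra.
exists (Num.min del (e / K)); first by rewrite lt_min del0 divr_gt0.
move=> w; rewrite lt_min => /andP[w1 w2].
have := H _ w1; rewrite mul1r => {}H.
have -> : f w - f z = (f w - f z - (w - z) * d) + (w - z) * d by rewrite subrK.
apply: le_trans (normc_triangle _ _) _; rewrite normcM.
have : normc (w - z) * K <= e by rewrite -ler_pdivlMr // ltW.
by rewrite /K mulrDr mulr1 => Hk; apply: le_trans Hk; rewrite lerD2r.
Qed.

Lemma fcontD f g z : fcont f z -> fcont g z -> fcont (fun w => f w + g w) z.
Proof.
move=> Hf Hg e e0; have e2 : 0 < e / 2 by rewrite divr_gt0.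
have [d1 d10 H1] := Hf _ e2; have [d2 d20 H2] := Hg _ e2.
exists (Num.min d1 d2); first by rewrite lt_min d10.
move=> w; rewrite lt_min => /andP[/H1 w1 /H2 w2].
have -> : f w + g w - (f z + g z) = (f w - f z) + (g w - g z) by ring.
by apply: le_trans (normc_triangle _ _) _; lra.
Qed.

Lemma fcont_lip f z (K : R) : (forall w, normc (f w - f z) <= K * normc (w - z)) -> fcont f z.
Proof.
move=> H e e0; pose K' := 1 + `|K|.
have K0 : 0 < K' by rewrite /K'; have := normr_ge0 K; lra.
exists (e / K'); first exact: divr_gt0.
move=> w; rewrite ltr_pdivlMr // => wz; apply: le_trans (H w) _.
apply: le_trans (ltW wz); rewrite mulrC ler_wpM2l ?normc_ge0 //.
by rewrite /K'; have := ler_norm K; lra.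
Qed.

Lemma fcontZ k f z : fcont f z -> fcont (fun w => k * f w) z.
Proof.
move=> Hf e e0; pose K := 1 + normc k.
have K0 : 0 < K by rewrite /K; have := normc_ge0 k; lra.
have [d d0 H] := Hf (e / K) (divr_gt0 e0 K0); exists d => // w /H wz.
rewrite -mulrBr normcM; move: wz; rewrite ler_pdivlMr // /K mulrDr mulr1 mulrC.
by have := normc_ge0 (f w - f z); lra.
Qed.

Lemma ccont_line f (L : R -> R[i]) a b :
  (forall s t, normc (L s - L t) = `|s - t|) ->
  (forall t, a <= t <= b -> fcont f (L t)) -> ccont (fun t => f (L t)) a b.
Proof.
move=> HL Hf; split => t /Hf Hc; apply/cvgrPdist_le => e e0.
  have [del del0 H] := Hc _ e0; near=> s.
  rewrite distrC -raddfB; apply: le_trans (normr_Re _) _; apply: H.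
  rewrite HL distrC; near: s; exact: cvgr_dist_lt.
have [del del0 H] := Hc _ e0; near=> s.
rewrite distrC -raddfB; apply: le_trans (normr_Im _) _; apply: H.
rewrite HL distrC; near: s; exact: cvgr_dist_lt.
Unshelve. all: by end_near. Qed.

Lemma hline_dist y (s t : R) : normc ((s +i* y) - (t +i* y)) = `|s - t|.
Proof. by rewrite -normcR; congr normc; simpc. Qed.

Lemma vline_dist x (s t : R) : normc ((x +i* s) - (x +i* t)) = `|s - t|.
Proof.
have -> : (x +i* s) - (x +i* t) = 'i * (s - t)%:C by simpc.
by rewrite normcM normcR /= expr0n expr1n add0r sqrtr1 mul1r.
Qed.

Definition rect x0 x1 y0 y1 z :=
  x0 <= complex.Re z <= x1 /\ y0 <= complex.Im z <= y1.

Definition rect_edge x0 x1 y0 y1 z := rect x0 x1 y0 y1 z /\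
  [\/ complex.Re z = x0, complex.Re z = x1, complex.Im z = y0 | complex.Im z = y1].

(** The boundary is oriented counterclockwise. *)
Definition boxint f x0 x1 y0 y1 : R[i] :=
  csegint (fun t => f (t +i* y0)) x0 x1 - csegint (fun t => f (t +i* y1)) x0 x1
  + 'i * (csegint (fun t => f (x1 +i* t)) y0 y1 - csegint (fun t => f (x0 +i* t)) y0 y1).

Section Edges.
Variables (x0 x1 y0 y1 : R).
Hypotheses (x01 : x0 <= x1) (y01 : y0 <= y1).
Variable P : R[i] -> Prop.
Hypothesis HP : forall z, rect_edge x0 x1 y0 y1 z -> P z.

Lemma edge_bottom t : x0 <= t <= x1 -> P (t +i* y0).
Proof. by move=> H; apply: HP; split; [split; rewrite //= lexx|apply: Or43]. Qed.
Lemma edge_top t : x0 <= t <= x1 -> P (t +i* y1).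
Proof. by move=> H; apply: HP; split; [split; rewrite //= lexx andbT|apply: Or44]. Qed.
Lemma edge_left t : y0 <= t <= y1 -> P (x0 +i* t).
Proof. by move=> H; apply: HP; split; [split; rewrite //= lexx|apply: Or41]. Qed.
Lemma edge_right t : y0 <= t <= y1 -> P (x1 +i* t).
Proof. by move=> H; apply: HP; split; [split; rewrite //= lexx andbT|apply: Or42]. Qed.
End Edges.

Section Box.
Variables (x0 x1 y0 y1 : R).
Hypotheses (x01 : x0 <= x1) (y01 : y0 <= y1).

Lemma edge_ccont f : (forall z, rect_edge x0 x1 y0 y1 z -> fcont f z) ->
  [/\ ccont (fun t => f (t +i* y0)) x0 x1, ccont (fun t => f (t +i* y1)) x0 x1,
      ccont (fun t => f (x0 +i* t)) y0 y1 & ccont (fun t => f (x1 +i* t)) y0 y1].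
Proof.
move=> H; split; apply: ccont_line; try exact: hline_dist; try exact: vline_dist.
- exact: (edge_bottom y01 H).
- exact: (edge_top y01 H).
- exact: (edge_left x01 H).
- exact: (edge_right x01 H).
Qed.

Lemma boxintD f g : (forall z, rect_edge x0 x1 y0 y1 z -> fcont f z) ->
  (forall z, rect_edge x0 x1 y0 y1 z -> fcont g z) ->
  boxint (fun z => f z + g z) x0 x1 y0 y1 = boxint f x0 x1 y0 y1 + boxint g x0 x1 y0 y1.
Proof.
move=> /edge_ccont [f1 f2 f3 f4] /edge_ccont [g1 g2 g3 g4]; rewrite /boxint !csegintD //.
ring.
Qed.

Lemma boxintZ k f : (forall z, rect_edge x0 x1 y0 y1 z -> fcont f z) ->
  boxint (fun z => k * f z) x0 x1 y0 y1 = k * boxint f x0 x1 y0 y1.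
Proof.
by move=> /edge_ccont [f1 f2 f3 f4]; rewrite /boxint !csegintZ //; ring.
Qed.

Lemma boxint_bound f M : (forall z, rect_edge x0 x1 y0 y1 z -> fcont f z) ->
  (forall z, rect_edge x0 x1 y0 y1 z -> normc (f z) <= M) ->
  normc (boxint f x0 x1 y0 y1) <= 4 * M * (x1 - x0 + (y1 - y0)).
Proof.
move=> /edge_ccont [f1 f2 f3 f4] H; rewrite /boxint.
have b1 := csegint_bound x01 f1 (edge_bottom y01 H).
have b2 := csegint_bound x01 f2 (edge_top y01 H).
have b3 := csegint_bound y01 f3 (edge_left x01 H).
have b4 := csegint_bound y01 f4 (edge_right x01 H).
apply: le_trans (normc_triangle _ _) _; rewrite normcM.
have -> : normc ('i : R[i]) = 1 by rewrite /= expr0n expr1n add0r sqrtr1.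
rewrite mul1r.
have := normc_sub (csegint (fun t => f (t +i* y0)) x0 x1) (csegint (fun t => f (t +i* y1)) x0 x1).
have := normc_sub (csegint (fun t => f (x1 +i* t)) y0 y1) (csegint (fun t => f (x0 +i* t)) y0 y1).
lra.
Qed.

End Box.

(** The two integrals over the common edge cancel. *)
Lemma boxint_splitx f x0 x1 x2 y0 y1 : x0 <= x1 -> x1 <= x2 -> y0 <= y1 ->
  (forall z, rect_edge x0 x2 y0 y1 z -> fcont f z) ->
  boxint f x0 x2 y0 y1 = boxint f x0 x1 y0 y1 + boxint f x1 x2 y0 y1.
Proof.
move=> x01 x12 y01 /(edge_ccont (le_trans x01 x12) y01) [f1 f2 _ _].
by rewrite /boxint (csegint_cat x01 x12 f1) (csegint_cat x01 x12 f2); ring.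
Qed.

Lemma boxint_splity f x0 x1 y0 y1 y2 : x0 <= x1 -> y0 <= y1 -> y1 <= y2 ->
  (forall z, rect_edge x0 x1 y0 y2 z -> fcont f z) ->
  boxint f x0 x1 y0 y2 = boxint f x0 x1 y0 y1 + boxint f x0 x1 y1 y2.
Proof.
move=> x01 y01 y12 /(edge_ccont x01 (le_trans y01 y12)) [_ _ f3 f4].
by rewrite /boxint (csegint_cat y01 y12 f3) (csegint_cat y01 y12 f4); ring.
Qed.

Lemma csegint_cst k a b : a <= b -> csegint (fun=> k) a b = (b - a)%:C * k.
Proof.
by move=> ab; case: k => p q; rewrite /csegint /= !segint_cst //; simpc; rewrite ![_ * (b - a)]mulrC.
Qed.

Lemma boxint_cst k x0 x1 y0 y1 : x0 <= x1 -> y0 <= y1 -> boxint (fun=> k) x0 x1 y0 y1 = 0.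
Proof. by move=> x01 y01; rewrite /boxint !csegint_cst // !subrr mulr0 addr0. Qed.

Lemma csegint_hline y a b : a <= b ->
  csegint (fun t => t +i* y) a b = ((b ^+ 2 - a ^+ 2) / 2) +i* (y * (b - a)).
Proof. by move=> ab; rewrite /csegint /= segint_id // segint_cst. Qed.

Lemma csegint_vline x a b : a <= b ->
  csegint (fun t => x +i* t) a b = (x * (b - a)) +i* ((b ^+ 2 - a ^+ 2) / 2).
Proof. by move=> ab; rewrite /csegint /= segint_id // segint_cst. Qed.

Lemma boxint_id x0 x1 y0 y1 : x0 <= x1 -> y0 <= y1 -> boxint id x0 x1 y0 y1 = 0.
Proof.
move=> x01 y01; rewrite /boxint !csegint_hline // !csegint_vline //; simpc.
by apply/eqP; rewrite eq_complex /=; apply/andP; split; apply/eqP; field.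
Qed.

End BoxIntegral.

(** * Cauchy's theorem for rectangles *)

Section Goursat.
Variable R : realType.
Implicit Types (f g : R[i] -> R[i]) (a b c : R) (z : R[i]).

Lemma nested_intervals (a b : nat -> R) :
  (forall n, a n <= a n.+1) -> (forall n, b n.+1 <= b n) -> (forall n, a n <= b n) ->
  exists x, forall n, a n <= x <= b n.
Proof.
move=> Ha Hb Hab.
have /nondecreasing_seqP ma := Ha; have /nonincreasing_seqP mb := Hb.
have ab m n : a m <= b n.
  case: (leqP m n) => mn; first exact: le_trans (ma _ _ mn) (Hab n).
  exact: le_trans (Hab m) (mb _ _ (ltnW mn)).
exists (sup (range a)) => n; apply/andP; split.
  apply: ub_le_sup; last by exists n.
  by exists (b 0) => _ [m _ <-].
apply: ge_sup; first by exists (a 0); exists 0.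
by move=> _ [m _ <-].
Qed.

(** Only the outer edges and the two cutting lines matter: the function may be
    singular inside each quarter. *)
Lemma boxint_cross f x0 x x1 y0 y y1 : x0 <= x -> x <= x1 -> y0 <= y -> y <= y1 ->
  (forall z, rect x0 x1 y0 y1 z ->
     rect_edge x0 x1 y0 y1 z \/ complex.Re z = x \/ complex.Im z = y -> fcont f z) ->
  boxint f x0 x1 y0 y1 =
  boxint f x0 x y0 y + boxint f x0 x y y1 + (boxint f x x1 y0 y + boxint f x x1 y y1).
Proof.
move=> x0x xx1 y0y yy1 H.
have x01 := le_trans x0x xx1; have y01 := le_trans y0y yy1.
rewrite (boxint_splitx x0x xx1 y01); last by move=> z [Hz Ez]; apply: H => //; left.
by rewrite !(@boxint_splity _ f _ _ y0 y y1) //;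
  move=> z [[/andP[h1 h2] h3] Ez]; (apply: H; first by split => //; lra);
  case: Ez => Ez; try (by right; left); left; split;
  do ?[by split => //; lra|by constructor].
Qed.

Record rectangle := Rect { rl : R; rr : R; rb : R; rt : R }.

Definition rectangle_boxint f (q : rectangle) := boxint f (rl q) (rr q) (rb q) (rt q).
Definition in_rect (q : rectangle) z := rect (rl q) (rr q) (rb q) (rt q) z.

Definition holo_rect f q :=
  [/\ rl q <= rr q, rb q <= rt q & forall z, in_rect q z -> cdiff f z].

Definition bisected f (q q' : rectangle) :=
  [/\ [/\ rl q <= rl q', rr q' <= rr q, rb q <= rb q' & rt q' <= rt q],
      rr q' - rl q' = (rr q - rl q) / 2,
      rt q' - rb q' = (rt q - rb q) / 2 &
      normc (rectangle_boxint f q) <= 4 * normc (rectangle_boxint f q')].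

(** One of the four quarters carries at least a quarter of the integral. *)
Lemma bisect f q : holo_rect f q -> exists q', holo_rect f q' /\ bisected f q q'.
Proof.
case: q => x0 x1 y0 y1 [/= x01 y01 H].
pose x := (x0 + x1) / 2; pose y := (y0 + y1) / 2.
have E : boxint f x0 x1 y0 y1 =
    boxint f x0 x y0 y + boxint f x0 x y y1 + (boxint f x x1 y0 y + boxint f x x1 y y1).
  apply: boxint_cross; rewrite /x /y; try lra.
  by move=> z Hz _; apply: cdiff_fcont; exact: H.
have ex : x - x0 = (x1 - x0) / 2 by rewrite /x; lra.
have ex' : x1 - x = (x1 - x0) / 2 by rewrite /x; lra.
have ey : y - y0 = (y1 - y0) / 2 by rewrite /y; lra.
have ey' : y1 - y = (y1 - y0) / 2 by rewrite /y; lra.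
pose N := normc (boxint f x0 x1 y0 y1).
have : [\/ N <= 4 * normc (boxint f x0 x y0 y), N <= 4 * normc (boxint f x0 x y y1),
           N <= 4 * normc (boxint f x x1 y0 y) | N <= 4 * normc (boxint f x x1 y y1)].
  case: (leP N (4 * normc (boxint f x0 x y0 y))) => h1; first exact: Or41.
  case: (leP N (4 * normc (boxint f x0 x y y1))) => h2; first exact: Or42.
  case: (leP N (4 * normc (boxint f x x1 y0 y))) => h3; first exact: Or43.
  apply: Or44.
  have := normc_triangle (boxint f x0 x y0 y + boxint f x0 x y y1)
            (boxint f x x1 y0 y + boxint f x x1 y y1); rewrite -E -/N.
  have := normc_triangle (boxint f x0 x y0 y) (boxint f x0 x y y1).
  have := normc_triangle (boxint f x x1 y0 y) (boxint f x x1 y y1).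
  lra.
case=> HN; [exists (Rect x0 x y0 y)|exists (Rect x0 x y y1)|
  exists (Rect x x1 y0 y)|exists (Rect x x1 y y1)];
 (split; [split => /=; [lra|lra|]|split => //=; split; lra]);
 move=> z [/= /andP[h1 h2] /andP[h3 h4]]; apply: H; split => /=; lra.
Qed.

Lemma boxint_affine (p q : R[i]) x0 x1 y0 y1 : x0 <= x1 -> y0 <= y1 ->
  boxint (fun z => p + q * z) x0 x1 y0 y1 = 0.
Proof.
move=> x01 y01.
have fid z : fcont id z by apply: (@fcont_lip _ _ _ 1) => w; rewrite mul1r.
have fcst z : fcont (fun=> p) z.
  by apply: (@fcont_lip _ _ _ 0) => w; rewrite subrr normc0 mul0r.
rewrite (boxintD x01 y01) //; last by move=> z _; apply: fcontZ; exact: fid.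
rewrite boxint_cst // (@boxintZ _ _ _ _ _ x01 y01 q id); last by move=> z _; exact: fid.
by rewrite boxint_id // mulr0 addr0.
Qed.

(** Bisecting repeatedly, the integral over the n-th rectangle is at least 4^-n
    times the original one. Near the common point of these rectangles the
    function is affine up to an error e |z - p|; the affine part integrates
    to 0, and the error contributes at most a constant times e 4^-n. *)
Lemma goursat f x0 x1 y0 y1 : x0 <= x1 -> y0 <= y1 ->
  (forall z, rect x0 x1 y0 y1 z -> cdiff f z) -> boxint f x0 x1 y0 y1 = 0.
Proof.
move=> x01 y01 Hf; pose q0 := Rect x0 x1 y0 y1.
have Hq0 : holo_rect f q0 by [].
have /choice [s Hs] : forall q, exists q', holo_rect f q -> holo_rect f q' /\ bisected f q q'.
  move=> q; have [/bisect [q' Hq']|nq] := pselect (holo_rect f q); first by exists q'.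
  by exists q.
pose Q n := iter n s q0.
have HQ n : holo_rect f (Q n) by elim: n => [//|n /Hs []].
have SQ n : bisected f (Q n) (Q n.+1) by have [] := Hs _ (HQ n).
have [X HX] : exists x, forall n, rl (Q n) <= x <= rr (Q n).
  by apply: nested_intervals => n; [case: (SQ n) => -[]..|case: (HQ n)].
have [Y HY] : exists x, forall n, rb (Q n) <= x <= rt (Q n).
  by apply: nested_intervals => n; [case: (SQ n) => -[]..|case: (HQ n)].
pose D := (x1 - x0) + (y1 - y0).
have D0 : 0 <= D by rewrite /D; lra.
have pw n : 0 < (2^-1 : R) ^+ n by rewrite exprn_gt0 // invr_gt0.
have wQ n : rr (Q n) - rl (Q n) + (rt (Q n) - rb (Q n)) = D * 2^-1 ^+ n.
  elim: n => [|n IH]; first by rewrite expr0 mulr1.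
  by case: (SQ n) => _ -> -> _; rewrite exprSr mulrA -IH; lra.
have bQ n : normc (rectangle_boxint f q0) <= 4 ^+ n * normc (rectangle_boxint f (Q n)).
  elim: n => [|n IH]; first by rewrite expr0 mul1r.
  case: (SQ n) => _ _ _ H; apply: le_trans IH _; rewrite exprSr -mulrA.
  by apply: ler_wpM2l; first exact: exprn_ge0.
have [d Hd] : cdiff f (X +i* Y) by case: (HQ 0%N) => _ _; apply; split; [exact: (HX 0%N)|exact: (HY 0%N)].
have key e : 0 < e -> normc (rectangle_boxint f q0) <= e * (4 * D ^+ 2).
  move=> e0; have [del del0 H] := Hd e e0.
  have [n Hn] : exists n, D * 2^-1 ^+ n < del.
    have := @cvg_geometric R D 2^-1; rewrite ger0_norm ?invr_ge0 // => /(_ _).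
    rewrite invf_lt1 // ltr1n => /(_ isT) /cvgrPdist_lt /(_ _ del0) [n _ /(_ n (leqnn n))].
    rewrite /= sub0r normrN => Hn; exists n; exact: le_lt_trans (ler_norm _) Hn.
  have dist z : in_rect (Q n) z -> normc (z - (X +i* Y)) <= D * 2^-1 ^+ n.
    move=> [/andP[h1 h2] /andP[h3 h4]]; apply: le_trans (normc_ReIm _) _.
    rewrite -wQ; have /andP[h5 h6] := HX n; have /andP[h7 h8] := HY n.
    by rewrite !raddfB /=; apply: lerD; rewrite ler_norml; lra.
  have [xx yy HQn] := HQ n.
  (* the affine approximation at the common point, and its error *)
  pose aff z := (f (X +i* Y) - d * (X +i* Y)) + d * z.
  pose err z := f z + (-1) * aff z.
  have caff z : fcont aff z.
    apply: (@fcont_lip _ _ _ (normc d)) => w; rewrite -normcM /aff.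
    by rewrite (_ : _ - _ = d * (w - z)) //; ring.
  have cerr z : in_rect (Q n) z -> fcont err z.
    move=> Hz; apply: fcontD; first by apply: cdiff_fcont; exact: HQn.
    exact: fcontZ.
  have E : rectangle_boxint f (Q n) = rectangle_boxint err (Q n).
    rewrite /rectangle_boxint /err (boxintD xx yy); last 2 first.
    - by move=> z [Hz _]; apply: cdiff_fcont; exact: HQn.
    - by move=> z _; exact: fcontZ.
    by rewrite (boxintZ xx yy) // boxint_affine // mulr0 addr0.
  apply: le_trans (bQ n) _; rewrite E.
  have /= := @boxint_bound _ _ _ _ _ xx yy err (e * (D * 2^-1 ^+ n)) _ _.
  have -> : e * (4 * D ^+ 2) = 4 ^+ n * (4 * (e * (D * 2^-1 ^+ n)) * (D * 2^-1 ^+ n)).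
    have e4 : (4 : R) ^+ n * (2^-1 ^+ n * 2^-1 ^+ n) = 1.
      by rewrite -!exprMn (_ : 4 * _ = 1) ?expr1n //; field.
    by move: e4; move: (4 ^+ n) (2^-1 ^+ n) => u v uv; rewrite -[LHS]mulr1 -uv; ring.
  move=> HH; rewrite ler_wpM2l ?exprn_ge0 //; rewrite -{2}wQ; apply: HH.
  - by move=> z [Hz _]; exact: cerr.
  move=> z [Hz _]; have dz := dist z Hz.
  have -> : err z = f z - f (X +i* Y) - (z - (X +i* Y)) * d by rewrite /err /aff; ring.
  apply: le_trans (H _ _) _; first exact: le_lt_trans dz Hn.
  by rewrite ler_pM2l.
apply: eq0_normc; apply/eqP; rewrite eq_le normc_ge0 andbT.
apply/ler_addgt0Pl => e e0; rewrite addr0.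
pose K := 4 * D ^+ 2 + 1; have K0 : 0 < K by rewrite /K; nra.
apply: le_trans (key (e / K) (divr_gt0 e0 K0)) _.
by rewrite mulrAC ler_pdivrMr //; apply: ler_wpM2l; [exact: ltW|rewrite /K; lra].
Qed.

End Goursat.

(** * Contour integrals around a covered Cantor set *)

Section Cover.
Variable R : realType.
Implicit Types (f g : R[i] -> R[i]) (s t : R) (z w p : R[i]) (q : nat -> R).

(** Cutting the frame into four rectangles, Cauchy's theorem applies to each. *)
Lemma boxint_frame f x0 x1 x2 x3 y0 y1 y2 y3 :
  [/\ x0 <= x1, x1 <= x2 & x2 <= x3] -> [/\ y0 <= y1, y1 <= y2 & y2 <= y3] ->
  (forall z, rect x0 x3 y0 y3 z ->
     ~ (x1 < complex.Re z < x2 /\ y1 < complex.Im z < y2) -> cdiff f z) ->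
  boxint f x0 x3 y0 y3 = boxint f x1 x2 y1 y2.
Proof.
move=> [x01 x12 x23] [y01 y12 y23] H.
have x13 := le_trans x12 x23; have y13 := le_trans y12 y23.
have x03 := le_trans x01 x13; have y03 := le_trans y01 y13.
have E z : rect x0 x3 y0 y3 z ->
    (complex.Re z <= x1 \/ x2 <= complex.Re z) \/
    (complex.Im z <= y1 \/ y2 <= complex.Im z) -> cdiff f z.
  by move=> Hz Ez; apply: H => // -[]; lra.
have Z1 : boxint f x0 x1 y0 y3 = 0.
  by apply: goursat => // z [h1 h2]; apply: E; [split; lra|left; left; lra].
have Z2 : boxint f x2 x3 y0 y3 = 0.
  by apply: goursat => // z [h1 h2]; apply: E; [split; lra|left; right; lra].
have Z3 : boxint f x1 x2 y0 y1 = 0.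
  by apply: goursat => // z [h1 h2]; apply: E; [split; lra|right; left; lra].
have Z4 : boxint f x1 x2 y2 y3 = 0.
  by apply: goursat => // z [h1 h2]; apply: E; [split; lra|right; right; lra].
rewrite (boxint_splitx x01 x13 y03); last first.
  by move=> z [[h1 h2] h3]; apply: cdiff_fcont; apply: E; [split; lra|case: h3; lra].
rewrite Z1 add0r (boxint_splitx x12 x23 y03); last first.
  by move=> z [[h1 h2] h3]; apply: cdiff_fcont; apply: E; [split; lra|case: h3; lra].
rewrite Z2 addr0 (boxint_splity x12 y01 y13); last first.
  by move=> z [[h1 h2] h3]; apply: cdiff_fcont; apply: E; [split; lra|case: h3; lra].
rewrite Z3 add0r (boxint_splity x12 y12 y23); last first.
  by move=> z [[h1 h2] h3]; apply: cdiff_fcont; apply: E; [split; lra|case: h3; lra].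
by rewrite Z4 addr0.
Qed.

(** The coordinate 2/5 makes the discs of radius 2/5 about the corners
    non-overlapping and, since |c| <= 3/5, contained in the unit disc. *)
Definition corner (b c : bool) : R[i] :=
  (if b then 2 / 5 else - (2 / 5)) +i* (if c then 2 / 5 else - (2 / 5)).

Lemma corner_le b c : normc (corner b c) <= 3 / 5.
Proof.
rewrite -(@ler_pXn2r _ 2) ?nnegrE ?normc_ge0 // normc_sqr.
by case: b; case: c => /=; lra.
Qed.

(** The union of the 4^N discs of generation N inside the disc of centre [p] and
    radius [s], where generation m + 1 is contracted by [q m]. The index [m]
    travels with the recursion because the ratios change from one generation
    to the next. *)
Fixpoint cantor_cover q (N m : nat) p s z : Prop :=
  if N is N'.+1 then exists b c, cantor_cover q N' m.+1 (p + s%:C * corner b c) (s * q m) z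
  else normc (z - p) <= s.

Section CoverBox.
Variable q : nat -> R.
Hypothesis q_gt0 : forall m, 0 < q m.
Hypothesis q_le : forall m, q m <= 3 / 10.

Lemma cantor_cover_le N m p s z : 0 < s -> cantor_cover q N m p s z -> normc (z - p) <= s.
Proof.
elim: N m p s => [//|N IH] m p s s0 /= [b [c /IH]].
move=> /(_ (mulr_gt0 s0 (q_gt0 m))) H.
rewrite (_ : z - p = (z - (p + s%:C * corner b c)) + s%:C * corner b c); last by ring.
apply: le_trans (normc_triangle _ _) _.
rewrite normcM normcR gtr0_norm //.
have : s * normc (corner b c) <= s * (3 / 5) by rewrite ler_pM2l // corner_le.
have : s * q m <= s * (3 / 10) by rewrite ler_pM2l // q_le.
lra.
Qed.

(** The half-side is 5/4 of the radius of the disc at the centre, so that the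
    boundary stays away from the disc. *)
Definition square p s : R[i] -> Prop :=
  rect (complex.Re p - 5 / 4 * s) (complex.Re p + 5 / 4 * s)
       (complex.Im p - 5 / 4 * s) (complex.Im p + 5 / 4 * s).

Definition square_boxint f p s := boxint f
  (complex.Re p - 5 / 4 * s) (complex.Re p + 5 / 4 * s)
  (complex.Im p - 5 / 4 * s) (complex.Im p + 5 / 4 * s).

Definition quadrant p (b c : bool) z :=
  (if b then complex.Re p <= complex.Re z else complex.Re z <= complex.Re p) /\
  (if c then complex.Im p <= complex.Im z else complex.Im z <= complex.Im p).

Lemma Re_subcenter p s b c : complex.Re (p + s%:C * corner b c) =
  complex.Re p + s * (if b then 2 / 5 else - (2 / 5)).
Proof. by case: p => x y /=; rewrite mul0r subr0. Qed.

Lemma Im_subcenter p s b c : complex.Im (p + s%:C * corner b c) =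
  complex.Im p + s * (if c then 2 / 5 else - (2 / 5)).
Proof. by case: p => x y /=; rewrite mul0r addr0. Qed.

Lemma subcenter_near p s b c z (x : R) : normc (z - (p + s%:C * corner b c)) <= x ->
  (`|complex.Re z - (complex.Re p + s * (if b then 2 / 5 else - (2 / 5)))| <= x /\
   `|complex.Im z - (complex.Im p + s * (if c then 2 / 5 else - (2 / 5)))| <= x).
Proof.
rewrite -(Re_subcenter p s b c) -(Im_subcenter p s b c) -!raddfB => H.
by split; [exact: le_trans (normr_Re _) H|exact: le_trans (normr_Im _) H].
Qed.

(** Each quadrant meets the discs of only one corner, because the discs have
    radius at most 3/10 < 2/5. *)
Lemma cantor_cover_quadrant N m p s z b c : 0 < s -> quadrant p b c z ->
  cantor_cover q N.+1 m p s z -> cantor_cover q N m.+1 (p + s%:C * corner b c) (s * q m) z.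
Proof.
move=> s0 [Hb Hc] /= [b' [c' Hz]].
suff [-> ->] : b = b' /\ c = c' by [].
have /subcenter_near := cantor_cover_le (mulr_gt0 s0 (q_gt0 m)) Hz.
have : s * q m <= s * (3 / 10) by rewrite ler_pM2l // q_le.
rewrite !ler_norml; move: Hz => _ sq [].
move=> /andP[h1 h2] /andP[h3 h4].
split; [case: b Hb; case: b' h1 h2|case: c Hc; case: c' h3 h4] => //; lra.
Qed.

(** Induction on the generation: a square integral is the sum of the integrals
    over its four quadrants, and in each quadrant the contour can be shrunk to
    the square about the disc of the next generation. At generation 0 the bound
    is a multiple of the length of the contour. *)
Lemma covered_boxint_bound f N m p s : 0 < s ->
  (forall z, square p s z -> ~ cantor_cover q N m p s z -> cdiff f z /\ normc (f z) <= 1) ->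
  normc (square_boxint f p s) <= 40 * 4 ^+ N * s * \prod_(i < N) q (m + i)%N.
Proof.
elim: N m p s => [|N IH] m p s s0 H.
  rewrite big_ord0 mulr1 expr0 mulr1.
  have xx : complex.Re p - 5 / 4 * s <= complex.Re p + 5 / 4 * s by lra.
  have yy : complex.Im p - 5 / 4 * s <= complex.Im p + 5 / 4 * s by lra.
  have HE z : rect_edge (complex.Re p - 5 / 4 * s) (complex.Re p + 5 / 4 * s)
       (complex.Im p - 5 / 4 * s) (complex.Im p + 5 / 4 * s) z ->
       cdiff f z /\ normc (f z) <= 1.
    move=> [Hz Ez]; apply: H => //= zp.
    have := le_trans (normr_Re (z - p)) zp; have := le_trans (normr_Im (z - p)) zp.
    by rewrite !raddfB /= !ler_norml; case: Ez; lra.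
  apply: le_trans (boxint_bound xx yy (M := 1) _ _) _.
  - by move=> z /HE [/cdiff_fcont].
  - by move=> z /HE [].
  lra.
have sq0 : 0 < s * q m by exact: mulr_gt0.
have sq : s * q m <= s * (3 / 10) by rewrite ler_pM2l // q_le.
have off z : square p s z -> ~ cantor_cover q N.+1 m p s z -> cdiff f z.
  by move=> h1 h2; case: (H z h1 h2).
have far z b c : quadrant p b c z -> square p s z ->
    ~ normc (z - (p + s%:C * corner b c)) <= s * q m -> cdiff f z.
  move=> qz sz nz; apply: off => // /(cantor_cover_quadrant s0 qz).
  by move/(cantor_cover_le sq0).
have sub b c : normc (square_boxint f (p + s%:C * corner b c) (s * q m)) <=
    40 * 4 ^+ N * (s * q m) * \prod_(i < N) q (m.+1 + i)%N.
  apply: IH => // z sz nz.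
  have qz : quadrant p b c z.
    move: sz; rewrite /square /rect Re_subcenter Im_subcenter /quadrant.
    by case: b {nz}; case: c; lra.
  apply: H; last by move/(cantor_cover_quadrant s0 qz).
  move: sz; rewrite /square /rect Re_subcenter Im_subcenter.
  by case: b {nz qz}; case: c; lra.
have frame b c : boxint f (complex.Re p - (if b then 0 else 5 / 4 * s))
    (complex.Re p + (if b then 5 / 4 * s else 0))
    (complex.Im p - (if c then 0 else 5 / 4 * s))
    (complex.Im p + (if c then 5 / 4 * s else 0))
    = square_boxint f (p + s%:C * corner b c) (s * q m).
  rewrite /square_boxint Re_subcenter Im_subcenter; apply: boxint_frame.
  - by case: b; split; lra.
  - by case: c; split; lra.
  move=> z [h1 h2] h3; apply: (far z b c).
  - by rewrite /quadrant; move: h1 h2; case: b {h3}; case: c; lra.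
  - by rewrite /square /rect; move: h1 h2; case: b {h3}; case: c; lra.
  move=> /subcenter_near; rewrite !ler_norml => h4; apply: h3; lra.
have -> : square_boxint f p s =
    square_boxint f (p + s%:C * corner false false) (s * q m) +
    square_boxint f (p + s%:C * corner false true) (s * q m) +
    (square_boxint f (p + s%:C * corner true false) (s * q m) +
     square_boxint f (p + s%:C * corner true true) (s * q m)).
  rewrite -!frame !subr0 !addr0; apply: boxint_cross; try lra.
  move=> z sz ez; apply: cdiff_fcont; apply: off => // -[b [c /(cantor_cover_le sq0) /subcenter_near]].
  rewrite !ler_norml; case: ez => [[_ [] ez]|[ez|ez]]; case: b; case: c; lra.
set K := 40 * _ * _ * _ in sub.
have -> : 40 * 4 ^+ N.+1 * s * \prod_(i < N.+1) q (m + i)%N = 4 * K.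
  rewrite big_ord_recl addn0 /K exprS.
  under eq_bigr do rewrite lift0 addnS -addSn.
  ring.
have h1 := sub false false; have h2 := sub false true.
have h3 := sub true false; have h4 := sub true true.
apply: le_trans (normc_triangle _ _) _.
have := normc_triangle (square_boxint f (p + s%:C * corner false false) (s * q m))
  (square_boxint f (p + s%:C * corner false true) (s * q m)).
have := normc_triangle (square_boxint f (p + s%:C * corner true false) (s * q m))
  (square_boxint f (p + s%:C * corner true true) (s * q m)).
lra.
Qed.

End CoverBox.
End Cover.

(** * Sets with covers of vanishing total size *)

Section Removable.
Variable R : realType.
Implicit Types (s t M : R) (z w p : R[i]) (q : nat -> R).

Lemma fcont_inv z : z != 0 -> fcont (fun w : R[i] => w^-1) z.
Proof.
move=> z0 e e0; have nz : 0 < normc z by rewrite normc_gt0.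
exists (Num.min (normc z / 2) (e * (normc z ^+ 2 / 2))).
  by rewrite lt_min !mulr_gt0 ?exprn_gt0 ?invr_gt0.
move=> w; rewrite lt_min => /andP[w1 w2].
have nw : normc z / 2 < normc w.
  by have := normc_distl z w; rewrite normcB; lra.
have w0 : w != 0 by rewrite -normc_gt0; apply: lt_trans nw; rewrite divr_gt0.
have -> : w^-1 - z^-1 = (z - w) * (w * z)^-1 by field; rewrite z0.
rewrite normcM normcV normcM normcB ler_pdivrMr; last by rewrite mulr_gt0 // normc_gt0.
apply: le_trans (ltW w2) _; rewrite ler_pM2l //.
by rewrite expr2 mulrAC ler_pM2r // ltW.
Qed.

Lemma inv_complex (x y : R) : (x +i* y)^-1 =
  (x / (x ^+ 2 + y ^+ 2)) +i* (- (y / (x ^+ 2 + y ^+ 2))).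
Proof. by []. Qed.

(** The exact value is 2 pi i. Every side contributes at least 1 to the imaginary
    part, as the integrand is at least 1/(2M) there. *)
Lemma boxint_inv_lower M : 0 < M -> 4 <= normc (boxint (fun w : R[i] => w^-1) (- M) M (- M) M).
Proof.
move=> M0; have MM : - M <= M by lra.
apply: le_trans (normr_Im _); apply: le_trans (ler_norm _).
have H z : rect_edge (- M) M (- M) M z -> fcont (fun w : R[i] => w^-1) z.
  move=> [_ Ez]; apply: fcont_inv; apply/eqP => z0; move: Ez; rewrite z0 /=.
  by case; lra.
have [[c1 c1'] [c2 c2'] [c3 c3'] [c4 c4']] := edge_ccont MM MM H.
have bnd (g : R -> R) : cont_seg g (- M) M ->
    (forall t, - M <= t <= M -> (2 * M)^-1 <= g t) -> 1 <= segint g (- M) M.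
  move=> cg Hg; have := segint_le (@cont_seg_cst R (2 * M)^-1 (- M) M) cg Hg.
  rewrite segint_cst // (_ : _^-1 * _ = 1) //; field; lra.
have bnd' (g : R -> R) : cont_seg g (- M) M ->
    (forall t, - M <= t <= M -> g t <= - (2 * M)^-1) -> segint g (- M) M <= - 1.
  move=> cg Hg; have := segint_le cg (@cont_seg_cst R (- (2 * M)^-1) (- M) M) Hg.
  rewrite segint_cst // (_ : - _^-1 * _ = - 1) //; field; lra.
have den t : - M <= t <= M -> 0 < t ^+ 2 + M ^+ 2 /\ (2 * M)^-1 <= M / (t ^+ 2 + M ^+ 2).
  move=> tM; have h0 : 0 < t ^+ 2 + M ^+ 2 by nra.
  split=> //; rewrite ler_pdivlMr // mulrC ler_pdivrMr; last by lra.
  nra.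
have b1 := bnd _ c1'; have b2 := bnd' _ c2'; have b3 := bnd' _ c3; have b4 := bnd _ c4.
have {}b1 : 1 <= segint (fun t => complex.Im (t +i* - M)^-1) (- M) M.
  apply: b1 => t /den [_]; rewrite inv_complex /= sqrrN mulNr opprK //.
have {}b2 : segint (fun t => complex.Im (t +i* M)^-1) (- M) M <= -1.
  by apply: b2 => t /den [_]; rewrite inv_complex /= lerN2.
have {}b3 : segint (fun t => complex.Re (- M +i* t)^-1) (- M) M <= -1.
  by apply: b3 => t /den [_]; rewrite inv_complex /= sqrrN mulNr lerN2 addrC.
have {}b4 : 1 <= segint (fun t => complex.Re (M +i* t)^-1) (- M) M.
  by apply: b4 => t /den [_]; rewrite inv_complex /= addrC.
rewrite /boxint /csegint; simpc; rewrite /=; lra.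
Qed.

Lemma norm_edge_ge M z : 0 <= M -> rect_edge (- M) M (- M) M z -> M <= normc z.
Proof.
move=> M0 [_ Ez]; have := normr_Re z; have := normr_Im z.
rewrite !ler_norml => /andP[h1 h2] /andP[h3 h4].
by case: Ez => Ez; rewrite Ez in h1 h2 h3 h4; lra.
Qed.

(** The integral over a large square of half-side M is 0 by the covers. By the
    expansion at infinity it is also f'(infinity) times the integral of 1/z, up
    to an error that tends to 0 as M grows. *)
Lemma covered_deriv_infty q (S : set (C R)) (f : sphere R -> C R) :
  (forall m, 0 < q m) -> (forall m, q m <= 3 / 10) ->
  (forall e : R, 0 < e -> exists N, 4 ^+ N * \prod_(i < N) q i <= e) ->
  (forall N z, S z -> cantor_cover q N 0 0 1 z) ->
  analytic_on (sphere_compl S) f ->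
  (forall z, ~ S z -> normc (f (Some z)) <= 1) ->
  deriv_infty f = 0.
Proof.
move=> q0 qle qlim SC fan f1.
pose F : R[i] -> R[i] := fun z => f (Some z).
have Fd z : ~ S z -> cdiff F z.
  by move=> nS; apply/analytic_at_Some; apply: fan => -[w Sw [wz]]; apply: nS; rewrite -wz.
have J0 : square_boxint F 0 1 = 0.
  apply: eq0_normc; apply/eqP; rewrite eq_le normc_ge0 andbT.
  apply/ler_addgt0Pl => e e0; rewrite addr0.
  have [N HN] := qlim (e / 40) (divr_gt0 e0 (ltr0Sn _ _)).
  have := @covered_boxint_bound R q q0 qle F N 0 0 1 ltr01 _.
  have H z : square 0 1 z -> ~ cantor_cover q N 0 0 1 z -> cdiff F z /\ normc (F z) <= 1.
    by move=> _ nc; split; [apply: Fd|apply: f1] => /(SC N).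
  move=> /(_ H); under eq_bigr do rewrite add0n.
  lra.
have [d Hd] : exists d : C R, forall e : R, 0 < e -> exists M : R, forall z, M < normc z ->
     normc (z * (f (Some z) - f infty) - d) <= e.
  by apply: analytic_infty_expansion; apply: fan => -[].
have -> : deriv_infty f = d by exact: deriv_infty_eq.
suff key (e : R) : 0 < e -> 4 * normc d <= 16 * e.
  apply: eq0_normc; apply/eqP; rewrite eq_le normc_ge0 andbT.
  apply/ler_addgt0Pl => e e0; rewrite addr0.
  have := key (e / 16) (divr_gt0 e0 (ltr0Sn _ _)).
  by have := normc_ge0 d; lra.
move=> e0; have [M0 HM0] := Hd e e0.
(* beyond M0 the expansion at infinity is accurate up to e *)
pose M : R := `|M0| + 2.
have M_gt : M0 < M by rewrite /M; have := ler_norm M0; lra.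
have M2 : 2 <= M by rewrite /M; have := normr_ge0 M0; lra.
have MM : - M <= M by lra.
have nS z : 1 < normc z -> ~ S z.
  by move=> z1 /(SC 0%N) /=; rewrite subr0; lra.
have edge z : rect_edge (- M) M (- M) M z -> M <= normc z by apply: norm_edge_ge; lra.
have J : boxint F (- M) M (- M) M = 0.
  rewrite -J0 /square_boxint /= !add0r; apply: boxint_frame; try by split; lra.
  move=> z _ nz; apply: Fd; apply: nS; rewrite ltNge; apply/negP => z1; apply: nz.
  have := le_trans (normr_Re z) z1; have := le_trans (normr_Im z) z1.
  by rewrite !ler_norml; lra.
have n0 z : rect_edge (- M) M (- M) M z -> z != 0.
  by move=> /edge ez; rewrite -normc_gt0; lra.
have cF z : rect_edge (- M) M (- M) M z -> fcont F z.
  by move=> /edge ez; apply: cdiff_fcont; apply: Fd; apply: nS; lra.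
have cI z : rect_edge (- M) M (- M) M z -> fcont (fun w : R[i] => w^-1) z.
  by move=> /n0; exact: fcont_inv.
pose err z := F z + (-1) * (f infty + d * z^-1).
have cc z : fcont (fun=> f infty : R[i]) z.
  by apply: (@fcont_lip _ _ _ 0) => w; rewrite subrr normc0 mul0r.
have cdI z : rect_edge (- M) M (- M) M z -> fcont (fun w : R[i] => f infty + d * w^-1) z.
  by move=> /cI Hz; apply: fcontD => //; exact: fcontZ.
have cE z : rect_edge (- M) M (- M) M z -> fcont err z.
  by move=> Hz; apply: fcontD; [exact: cF|apply: fcontZ; exact: cdI].
have E : boxint err (- M) M (- M) M = - (d * boxint (fun w : R[i] => w^-1) (- M) M (- M) M).
  rewrite /err (boxintD MM MM) //; last by move=> z Hz; apply: fcontZ; exact: cdI.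
  rewrite J add0r (boxintZ MM MM) // (boxintD MM MM) //; last by move=> z Hz; apply: fcontZ; exact: cI.
  by rewrite boxint_cst // add0r (boxintZ MM MM) // mulN1r.
have := @boxint_bound _ _ _ _ _ MM MM err (e / M) cE _.
rewrite E normc_opp normcM => H.
have {}H : normc d * normc (boxint (fun w : R[i] => w^-1) (- M) M (- M) M) <=
    4 * (e / M) * (M - - M + (M - - M)).
  apply: H => z Hz; have ez := edge z Hz; have zn0 := n0 z Hz.
  have nz0 : 0 < normc z by rewrite normc_gt0.
  have -> : err z = (z * (f (Some z) - f infty) - d) * z^-1.
    by rewrite /err /F; field.
  rewrite normcM normcV ler_pdivrMr //.
  apply: le_trans (HM0 z _) _; first exact: lt_le_trans ez.
  by rewrite mulrAC ler_pdivlMr ?ler_pM2l //; lra.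
have hK := @boxint_inv_lower M (lt_le_trans (ltr0n _ 2) M2).
have : normc d * 4 <= normc d * normc (boxint (fun w : R[i] => w^-1) (- M) M (- M) M).
  by apply: ler_wpM2l => //; exact: normc_ge0.
have -> : 16 * e = 4 * (e / M) * (M - - M + (M - - M)) by field; rewrite gt_eqF //; lra.
lra.
Qed.

End Removable.

(** * Limits of complex sequences *)

Section Limits.
Variable R : realType.
Implicit Types (s t e : R) (z w l : R[i]) (u v : nat -> R[i]).

(** Convergence with real error bounds, as in [cdiff_to]. *)
Definition ccvg u l := forall e : R, 0 < e ->
  exists N, forall n, (N <= n)%N -> normc (u n - l) <= e.

Lemma real_cauchy (x : nat -> R) :
  (forall e : R, 0 < e -> exists N, forall n, (N <= n)%N -> `|x n - x N| <= e) ->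
  exists a : R, forall e : R, 0 < e -> exists N, forall n, (N <= n)%N -> `|x n - a| <= e.
Proof.
move=> H; have /R_complete : cauchy (x @ \oo).
  apply: cauchy_exP => e e0; have e2 : 0 < e / 2 by rewrite divr_gt0.
  have [N HN] := H _ e2; exists (x N), N => // n /= /HN Nn.
  by rewrite -ball_normE /= distrC; lra.
move/cvgrPdist_le => C; exists (lim (x @ \oo)) => e /C [N _ HN].
by exists N => n /HN; rewrite distrC.
Qed.

Lemma ccvg_cauchy u :
  (forall e : R, 0 < e -> exists N, forall n, (N <= n)%N -> normc (u n - u N) <= e) ->
  exists l, ccvg u l.
Proof.
move=> H.
have [x Hx] : exists x, forall e : R, 0 < e -> exists N, forall n, (N <= n)%N ->
    `|complex.Re (u n) - x| <= e.
  apply: real_cauchy => e /H [N HN]; exists N => n /HN; rewrite -raddfB.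
  exact: le_trans (normr_Re _).
have [y Hy] : exists x, forall e : R, 0 < e -> exists N, forall n, (N <= n)%N ->
    `|complex.Im (u n) - x| <= e.
  apply: real_cauchy => e /H [N HN]; exists N => n /HN; rewrite -raddfB.
  exact: le_trans (normr_Im _).
exists (x +i* y) => e e0; have e2 : 0 < e / 2 by rewrite divr_gt0.
have [N1 H1] := Hx _ e2; have [N2 H2] := Hy _ e2.
exists (maxn N1 N2) => n; rewrite geq_max => /andP[/H1 n1 /H2 n2].
by apply: le_trans (normc_ReIm _) _; rewrite !raddfB /=; lra.
Qed.

Lemma ccvg_unique u l l' : ccvg u l -> ccvg u l' -> l = l'.
Proof.
move=> H H'; apply/eqP; rewrite -subr_eq0; apply/eqP; apply: eq0_normc.
apply/eqP; rewrite eq_le normc_ge0 andbT; apply/ler_addgt0Pl => e e0; rewrite addr0.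
have e2 : 0 < e / 2 by rewrite divr_gt0.
have [N1 H1] := H _ e2; have [N2 H2] := H' _ e2.
have := H1 _ (leq_maxl N1 N2); have := H2 _ (leq_maxr N1 N2).
set n := maxn _ _ => h2 h1; rewrite (_ : l - l' = (u n - l') - (u n - l)); last by ring.
by apply: le_trans (normc_sub _ _) _; lra.
Qed.

Lemma ccvg_le u l z M : ccvg u l -> (forall n, normc (u n - z) <= M) ->
  normc (l - z) <= M.
Proof.
move=> H uM; apply/ler_addgt0Pl => e /H [N /(_ N (leqnn N)) HN].
rewrite (_ : l - z = (u N - z) - (u N - l)); last by ring.
by apply: le_trans (normc_sub _ _) _; have := uM N; lra.
Qed.

Lemma ccvg_cst l : ccvg (fun=> l) l.
Proof. by move=> e e0; exists 0%N => n _; rewrite subrr normc0 ltW. Qed.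

Lemma ccvgD u v l l' : ccvg u l -> ccvg v l' -> ccvg (fun n => u n + v n) (l + l').
Proof.
move=> H H' e e0; have e2 : 0 < e / 2 by rewrite divr_gt0.
have [N1 H1] := H _ e2; have [N2 H2] := H' _ e2.
exists (maxn N1 N2) => n; rewrite geq_max => /andP[/H1 n1 /H2 n2].
rewrite (_ : _ - _ = (u n - l) + (v n - l')); last by ring.
by apply: le_trans (normc_triangle _ _) _; lra.
Qed.

Lemma ccvgZ k u l : ccvg u l -> ccvg (fun n => k * u n) (k * l).
Proof.
move=> H e e0; pose K := 1 + normc k.
have K0 : 0 < K by rewrite /K; have := normc_ge0 k; lra.
have [N HN] := H _ (divr_gt0 e0 K0); exists N => n /HN.
rewrite -mulrBr normcM ler_pdivlMr // mulrC /K => h.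
by have := normc_ge0 (u n - l); lra.
Qed.

Lemma ccvg_shift u l : ccvg u l <-> ccvg (fun n => u n.+1) l.
Proof.
split=> H e /H [N HN]; first by exists N => n Nn; apply: HN; exact: leqW.
by exists N.+1 => -[//|n] /HN.
Qed.

(** A telescoping majorant gives both convergence and the rate [t]. *)
Lemma ccvg_telescope u (t : nat -> R) :
  (forall n, 0 <= t n) -> (forall e : R, 0 < e -> exists n, t n <= e) ->
  (forall n, normc (u n.+1 - u n) <= t n - t n.+1) ->
  exists l, ccvg u l /\ forall n, normc (l - u n) <= t n.
Proof.
move=> t0 tlim ut.
have tel N k : normc (u (N + k)%N - u N) <= t N - t (N + k)%N.
  elim: k => [|k IH]; first by rewrite addn0 !subrr normc0.
  rewrite addnS (_ : _ - _ = (u (N + k).+1 - u (N + k)%N) + (u (N + k)%N - u N)); last by ring.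
  by apply: le_trans (normc_triangle _ _) _; have := ut (N + k)%N; lra.
have tel' N n : (N <= n)%N -> normc (u n - u N) <= t N.
  by move/subnKC <-; have := tel N (n - N)%N; have := t0 (N + (n - N))%N; lra.
have [l Hl] : exists l, ccvg u l.
  apply: ccvg_cauchy => e /tlim [N HN]; exists N => n /tel' h; exact: le_trans HN.
exists l; split=> // N; apply/ler_addgt0Pl => e /Hl [N' HN'].
set n := maxn N N'.
rewrite (_ : l - u N = (u n - u N) - (u n - l)); last by ring.
apply: le_trans (normc_sub _ _) _.
by have := tel' N n (leq_maxl _ _); have := HN' n (leq_maxr _ _); lra.
Qed.

Definition clim u : R[i] := xget 0 [set l | ccvg u l].

Lemma clim_eq u l : ccvg u l -> clim u = l.
Proof.
move=> H; apply: (ccvg_unique _ H).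
exact: (xgetPex 0 (ex_intro [set l | ccvg u l] l H)).
Qed.

Lemma ccvg_clim u : (exists l, ccvg u l) -> ccvg u (clim u).
Proof. by case=> l H; rewrite (clim_eq H). Qed.

(** Pointwise limits inherit differentiability from a second-order Taylor bound
    that is uniform in n. Convergence of the derivatives need not be known in
    advance: the bound forces it. *)
Lemma cdiff_lim (f_ : nat -> R[i] -> R[i]) f z0 (d_ : nat -> R[i]) (r M : R) :
  0 < r -> (forall z, normc (z - z0) < r -> ccvg (f_ ^~ z) (f z)) ->
  (forall n z, normc (z - z0) < r ->
     normc (f_ n z - f_ n z0 - (z - z0) * d_ n) <= M * normc (z - z0) ^+ 2) ->
  cdiff f z0.
Proof.
move=> r0 Hf Hd; pose K := 1 + `|M|.
have K0 : 0 < K by rewrite /K; have := normr_ge0 M; lra.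
have MK : M <= K by rewrite /K; have := ler_norm M; lra.
have {}Hd n z : normc (z - z0) < r ->
     normc (f_ n z - f_ n z0 - (z - z0) * d_ n) <= K * normc (z - z0) ^+ 2.
  by move=> /(Hd n) h; apply: le_trans h _; apply: ler_wpM2r => //; exact: sqr_ge0.
have z0r : normc (z0 - z0) < r by rewrite subrr normc0.
have [d dd] : exists d, ccvg d_ d.
  apply: ccvg_cauchy => e e0.
  (* at a fixed increment [del] the difference quotients converge, and each
     differs from its slope by at most K del <= e/4 *)
  pose del := Num.min (r / 2) (e / (4 * K)).
  have del0 : 0 < del by rewrite lt_min !divr_gt0 // mulr_gt0.
  have delr : del < r by rewrite /del gt_min; apply/orP; left; lra.
  have delK : del * (4 * K) <= e.
    by rewrite -ler_pdivlMr ?mulr_gt0 // /del ge_min lexx orbT.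
  pose z := z0 + del%:C.
  have zE : z - z0 = del%:C by rewrite /z addrC addKr.
  have zr : normc (z - z0) < r by rewrite zE normcR gtr0_norm.
  have edel : 0 < e * del / 8 by rewrite !mulr_gt0 ?invr_gt0.
  have [N1 H1] := Hf z zr _ edel; have [N2 H2] := Hf z0 z0r _ edel.
  exists (maxn N1 N2) => n; rewrite geq_max => /andP[n1 n2].
  set m := maxn N1 N2.
  have h1 := H1 n n1; have h2 := H1 m (leq_maxl _ _).
  have h3 := H2 n n2; have h4 := H2 m (leq_maxr _ _).
  have h5 := Hd n z zr; have h6 := Hd m z zr.
  rewrite -(ler_pM2l del0) -{1}(gtr0_norm del0) -normcR -normcM -zE.
  rewrite zE normcR gtr0_norm // -zE in h5 h6.
  have -> : (z - z0) * (d_ n - d_ m) =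
     ((f_ n z - f z) - (f_ m z - f z)) - ((f_ n z0 - f z0) - (f_ m z0 - f z0))
     - ((f_ n z - f_ n z0 - (z - z0) * d_ n) - (f_ m z - f_ m z0 - (z - z0) * d_ m)).
    by ring.
  have t1 := normc_sub (f_ n z - f z) (f_ m z - f z).
  have t2 := normc_sub (f_ n z0 - f z0) (f_ m z0 - f z0).
  have t3 := normc_sub (f_ n z - f_ n z0 - (z - z0) * d_ n) (f_ m z - f_ m z0 - (z - z0) * d_ m).
  apply: le_trans (normc_sub _ _) _.
  have t4 := normc_sub ((f_ n z - f z) - (f_ m z - f z)) ((f_ n z0 - f z0) - (f_ m z0 - f z0)).
  have : K * del ^+ 2 <= del * e / 4 by rewrite expr2; nra.
  lra.
exists d => e e0; exists (Num.min r (e / K)); first by rewrite lt_min r0 divr_gt0.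
move=> z; rewrite lt_min => /andP[zr ze].
have C : ccvg (fun n => f_ n z + ((-1) * f_ n z0 + (- (z - z0)) * d_ n))
              (f z + ((-1) * f z0 + (- (z - z0)) * d)).
  apply: ccvgD; first exact: Hf.
  by apply: ccvgD; apply: ccvgZ => //; exact: Hf.
rewrite (_ : f z - _ - _ = f z + ((-1) * f z0 + (- (z - z0)) * d) - 0); last by ring.
apply: (ccvg_le C) => n; rewrite subr0.
rewrite (_ : _ + _ = f_ n z - f_ n z0 - (z - z0) * d_ n); last by ring.
apply: le_trans (Hd n z zr) _; rewrite expr2 mulrA ler_wpM2r ?normc_ge0 //.
by move: ze; rewrite ltr_pdivlMr // mulrC => /ltW.
Qed.

End Limits.

(** * The holomorphic motion *)

Section Motion.
Variable R : realType.
Implicit Types (s t : R) (z w l p : R[i]) (q : nat -> R).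

(** The product of the first n ratios, each multiplied by 4, is ((n + 11)/11)^2:
    it grows fast enough for its reciprocals to be summable, and slower than any
    exponential. The shift by 11 keeps the ratios
    below 3/10. *)
Definition contraction (m : nat) : R := ((m%:R + 12) / (m%:R + 11)) ^+ 2 / 4.

Lemma contraction_ge m : 1 / 4 <= contraction m.
Proof.
rewrite /contraction ler_pM2r ?invr_gt0 // -[leLHS](expr1n _ 2).
have h : 0 < m%:R + 11 :> R by have := ler0n R m; lra.
by rewrite ler_pXn2r ?nnegrE ?divr_ge0 // ?ler_pdivlMr //; lra.
Qed.

Lemma contraction_gt0 m : 0 < contraction m.
Proof. by apply: lt_le_trans (contraction_ge m); lra. Qed.

Lemma contraction_le m : contraction m <= 3 / 10.
Proof.
have h0 := ler0n R m; have h : 0 < m%:R + 11 :> R by lra.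
rewrite /contraction expr_div_n -mulrA -invfM ler_pdivrMr; last by rewrite mulr_gt0 // exprn_gt0.
by move: h0; move: (m%:R) => x x0; nra.
Qed.

Lemma prod_contraction m N : 4 ^+ N * \prod_(i < N) contraction (m + i) =
  (((m + N)%:R + 11) / (m%:R + 11)) ^+ 2.
Proof.
have p n : n%:R + 11 != 0 :> R by rewrite gt_eqF //; have := ler0n R n; lra.
elim: N => [|N IH]; first by rewrite big_ord0 addn0 divff ?p // expr1n expr0 mulr1.
rewrite big_ord_recr /= exprSr mulrACA IH /contraction addnS -(natr1 (m + N)%N).
have := p (m + N)%N; have := p m; move: (m%:R) ((m + N)%:R) => x y h1 h2.
by field; rewrite h1 h2.
Qed.

Lemma complexR_eq0 (x : R) : (x%:C == 0) = (x == 0).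
Proof. by rewrite -normc_eq0 normcR normr_eq0. Qed.

Lemma contractionC_neq0 m : (contraction m)%:C != 0.
Proof. by rewrite complexR_eq0 gt_eqF // contraction_gt0. Qed.

Lemma normc_contraction m : normc (contraction m)%:C = contraction m.
Proof. by rewrite normcR gtr0_norm // contraction_gt0. Qed.

Definition nearest_corner z : R[i] := corner R (0 <= complex.Re z) (0 <= complex.Im z).

Lemma nearest_corner_le z : normc (nearest_corner z) <= 3 / 5.
Proof. exact: corner_le. Qed.

Lemma nearest_corner_eq z b c : normc (z - corner R b c) < 2 / 5 -> nearest_corner z = corner R b c.
Proof.
move=> H; have := le_lt_trans (normr_Re _) H; have := le_lt_trans (normr_Im _) H.
rewrite !raddfB /= !ltr_norml => /andP[h1 h2] /andP[h3 h4].
rewrite /nearest_corner; congr corner.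
  by case: b {h1 h2 H} h3 h4 => h3 h4; [apply/idP|apply/negP]; lra.
by case: c {h3 h4 H} h1 h2 => h1 h2; [apply/idP|apply/negP]; lra.
Qed.

(** Equal to 1/5 up to radius 3/10 and to 0 from radius 2/5 on; as the
    slope in between is 2 and 1/5 + 2 (2/5) = 1, [drift] is 1-Lipschitz. *)
Definition bump t : R := Num.max 0 (Num.min (1 / 5) (2 * (2 / 5 - t))).

Lemma bump_cases t : [\/ t <= 3 / 10 /\ bump t = 1 / 5,
  [/\ 3 / 10 < t, t < 2 / 5 & bump t = 2 * (2 / 5 - t)] | 2 / 5 <= t /\ bump t = 0].
Proof.
rewrite /bump; case: (lerP t (3 / 10)) => h1.
  apply: Or31; split=> //; rewrite (min_idPl _); last by lra.
  by rewrite (max_idPr _) //; lra.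
case: (ltrP t (2 / 5)) => h2.
  apply: Or32; split=> //; rewrite (min_idPr _); last by lra.
  by rewrite (max_idPr _) //; lra.
apply: Or33; split=> //; rewrite (min_idPr _); last by lra.
by rewrite (max_idPl _) //; lra.
Qed.

Lemma bump_ge0 t : 0 <= bump t.
Proof. by case: (bump_cases t) => [[_ ->]|[h1 h2 ->]|[_ ->]]; lra. Qed.

Lemma bump_le t : bump t <= 1 / 5.
Proof. by case: (bump_cases t) => [[_ ->]|[h1 h2 ->]|[_ ->]]; lra. Qed.

Lemma bump_lip s t : `|bump s - bump t| <= 2 * `|s - t|.
Proof.
have h1 := ler_norm (s - t); have h2 := ler_norm (t - s); rewrite distrC in h2.
by case: (bump_cases s) => [[? ->]|[? ? ->]|[? ->]];
  case: (bump_cases t) => [[? ->]|[? ? ->]|[? ->]]; rewrite ler_norml; lra.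
Qed.

Definition drift z : R[i] := (bump (normc (z - nearest_corner z)))%:C * (z - nearest_corner z).

Lemma normc_drift z : normc (drift z) = bump (normc (z - nearest_corner z)) * normc (z - nearest_corner z).
Proof. by rewrite normcM normcR ger0_norm ?bump_ge0. Qed.

Lemma drift_far z : 2 / 5 <= normc (z - nearest_corner z) -> drift z = 0.
Proof.
by rewrite /drift; case: (bump_cases (normc (z - nearest_corner z))) => [[? ->]|[? ? ->]|[? ->]];
  rewrite ?mul0r // => ?; exfalso; lra.
Qed.

Lemma drift_near z : normc (z - nearest_corner z) <= 3 / 10 -> drift z = (1 / 5)%:C * (z - nearest_corner z).
Proof.
by rewrite /drift; case: (bump_cases (normc (z - nearest_corner z))) => [[? ->]|[? ? ->]|[? ->]] // ?; exfalso; lra.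
Qed.

(** This keeps every point in its disc of radius 2/5 as long as |l| <= 1. *)
Lemma drift_le_gap z : normc (z - nearest_corner z) < 2 / 5 ->
  normc (drift z) <= 2 / 5 - normc (z - nearest_corner z).
Proof.
rewrite normc_drift => h; have := normc_ge0 (z - nearest_corner z); move: h.
move: (normc _) => t h1 h2.
by case: (bump_cases t) => [[? ->]|[? ? ->]|[? ->]]; nra.
Qed.

Lemma drift_le z : normc (drift z) <= 1 / 10.
Proof.
rewrite normc_drift; have := normc_ge0 (z - nearest_corner z).
move: (normc _) => t h2.
by case: (bump_cases t) => [[? ->]|[? ? ->]|[? ->]]; nra.
Qed.

Lemma corner_dist b c b' c' : corner R b c != corner R b' c' ->
  4 / 5 <= normc (corner R b c - corner R b' c').
Proof.
move=> ne; have [bb|bb] := eqVneq b b'; last first.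
  apply: le_trans (normr_Re _); rewrite raddfB /= ler_normr.
  by move: bb; case: b ne; case: b' => //= _ _; lra.
apply: le_trans (normr_Im _); rewrite raddfB /= ler_normr.
move: ne; rewrite bb; have [->|] := eqVneq c c'; first by rewrite eqxx.
by case: c; case: c' => //= _ _; lra.
Qed.

(** For points in different discs, the displacements are at most the distances to
    the two circles, and the segment between the points crosses both gaps. *)
Lemma drift_lip z w : normc (drift z - drift w) <= normc (z - w).
Proof.
have mixed x y : normc (x - nearest_corner x) < 2 / 5 -> 2 / 5 <= normc (y - nearest_corner y) ->
    normc (drift x - drift y) <= normc (x - y).
  move=> hx hy; rewrite (drift_far hy) subr0.
  apply: le_trans (drift_le_gap hx) _.
  have : 2 / 5 <= normc (y - nearest_corner x).
    rewrite leNgt; apply/negP => h; have cy : nearest_corner y = nearest_corner x := nearest_corner_eq h.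
    by move: hy; rewrite cy leNgt h.
  rewrite (_ : y - nearest_corner x = (x - nearest_corner x) - (x - y)); last by ring.
  by have := normc_sub (x - nearest_corner x) (x - y); lra.
case: (ltP (normc (z - nearest_corner z)) (2 / 5)) => hz; case: (ltP (normc (w - nearest_corner w)) (2 / 5)) => hw.
- have [cc|cc] := eqVneq (nearest_corner z) (nearest_corner w).
    rewrite /drift cc; set c := nearest_corner w; rewrite -/c in hw; rewrite cc -/c in hz.
    set bz := bump _; set bw := bump _.
    rewrite (_ : _ - _ = bz%:C * (z - w) + (bz - bw)%:C * (w - c)); last first.
      by rewrite rmorphB; ring.
    apply: le_trans (normc_triangle _ _) _; rewrite !normcM !normcR ger0_norm ?bump_ge0 //.
    have h1 : bz <= 1 / 5 := bump_le _.
    have h2 : `|bz - bw| <= 2 * normc (z - w).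
      apply: le_trans (bump_lip _ _) _; rewrite ler_pM2l // ler_norml.
      have := normc_distl (z - c) (w - c); have := normc_distl (w - c) (z - c).
      rewrite (_ : w - c - (z - c) = - (z - w)); last by ring.
      rewrite (_ : z - c - (w - c) = z - w); last by ring.
      by rewrite normc_opp; lra.
    have h3 := normc_ge0 (z - w); have h4 := normc_ge0 (w - c).
    have h5 : bz * normc (z - w) <= 1 / 5 * normc (z - w) by apply: ler_wpM2r.
    have h6 : `|bz - bw| * normc (w - c) <= (2 * normc (z - w)) * (2 / 5).
      by apply: ler_pM => //; exact: ltW.
    lra.
  have := corner_dist cc; rewrite -/(nearest_corner z) -/(nearest_corner w) => h.
  apply: le_trans (normc_sub _ _) _.
  have := drift_le_gap hz; have := drift_le_gap hw.
  rewrite (_ : nearest_corner z - nearest_corner w = (z - w) - (z - nearest_corner z) + (w - nearest_corner w)) in h; last by ring.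
  have := normc_triangle ((z - w) - (z - nearest_corner z)) (w - nearest_corner w).
  have := normc_sub (z - w) (z - nearest_corner z).
  lra.
- exact: mixed.
- by rewrite normcB (normcB z); apply: mixed.
- by rewrite !drift_far // subrr normc0 normc_ge0.
Qed.

Definition flow l z := z + l * drift z.

(** The displacement l drift is a strict contraction when |l| < 1. *)
Lemma flow_inj l : normc l < 1 -> injective (flow l).
Proof.
move=> l1 z w E; apply/eqP; rewrite -subr_eq0 -normc_eq0; apply/eqP.
have : z - w = - (l * (drift z - drift w)).
  have : z - w + l * (drift z - drift w) = flow l z - flow l w by rewrite /flow; ring.
  by rewrite E subrr => /eqP; rewrite addr_eq0 => /eqP.
move=> H; have := drift_lip z w; have h0 := normc_ge0 (z - w).
have : normc (z - w) = normc l * normc (drift z - drift w) by rewrite {1}H normc_opp normcM.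
have := normc_ge0 (drift z - drift w); have := normc_ge0 l; nra.
Qed.

Lemma flow_disc l z : normc l <= 1 -> normc z <= 1 -> normc (flow l z) <= 1.
Proof.
move=> l1 z1; case: (ltP (normc (z - nearest_corner z)) (2 / 5)) => hz; last first.
  by rewrite /flow drift_far // mulr0 addr0.
rewrite (_ : flow l z = nearest_corner z + ((z - nearest_corner z) + l * drift z)); last first.
  by rewrite /flow; ring.
apply: le_trans (normc_triangle _ _) _; have := nearest_corner_le z.
have := normc_triangle (z - nearest_corner z) (l * drift z); rewrite normcM.
have := drift_le_gap hz; have := normc_ge0 (drift z); have := normc_ge0 l; nra.
Qed.

(** Points outside the discs of the next generation are sent to 2, a fixed point
    of [zoom] at which [drift] vanishes; so the series below stops there without
    a case distinction. *)
Definition zoom m z : R[i] :=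
  if normc (z - nearest_corner z) <= contraction m then (z - nearest_corner z) / (contraction m)%:C else 2.

Lemma zoom_near m z : normc (z - nearest_corner z) <= contraction m ->
  z = nearest_corner z + (contraction m)%:C * zoom m z.
Proof.
by rewrite /zoom => ->; rewrite mulrC divfK ?contractionC_neq0 //; rewrite addrC subrK.
Qed.

Lemma zoom_le1 m z : normc (z - nearest_corner z) <= contraction m -> normc (zoom m z) <= 1.
Proof.
move=> h; rewrite /zoom h normcM normcV normc_contraction ler_pdivrMr ?mul1r //.
exact: contraction_gt0.
Qed.

Lemma two_far : 2 / 5 <= normc (2 - nearest_corner 2).
Proof.
apply: le_trans (normr_Re _); rewrite raddfB /nearest_corner /=.
by rewrite addr_ge0 //= ler_normr; lra.
Qed.

Lemma drift2 : drift 2 = 0.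
Proof. exact: drift_far two_far. Qed.

Lemma zoom2 m : zoom m 2 = 2.
Proof.
by rewrite /zoom leNgt; have := two_far; have := contraction_le m => h1 h2;
  rewrite (_ : _ < _ = true) //; lra.
Qed.

Lemma fifth_norm : normc ((1 / 5)%:C : R[i]) = 1 / 5.
Proof. by rewrite normcR ger0_norm //; lra. Qed.

Lemma normc_one : normc (1 : R[i]) = 1.
Proof. exact: normc1. Qed.

(** The factor by which the motion dilates the inner discs. *)
Definition stretch l : R[i] := 1 + l * (1 / 5)%:C.

Lemma stretch_le l : normc l <= 1 -> normc (stretch l) <= 6 / 5.
Proof.
move=> l1; apply: le_trans (normc_triangle _ _) _.
rewrite normc_one normcM fifth_norm; lra.
Qed.

(** Partial sums of the power series of the motion, by recursion on the generation:
    the displacement seen in the zoomed picture is scaled back by the moved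
    contraction ratio. *)
Fixpoint partial_drift N m l w : R[i] :=
  if N is N'.+1 then drift w + stretch l * (contraction m)%:C * partial_drift N' m.+1 l (zoom m w) else 0.

Lemma partial_drift2 N m l : partial_drift N m l 2 = 0.
Proof. by elim: N m => [//|N IH] m /=; rewrite drift2 zoom2 IH mulr0 addr0. Qed.

Lemma stretch_contraction_le l m : normc l <= 1 -> normc (stretch l * (contraction m)%:C) <= 9 / 25.
Proof.
move=> /stretch_le h; rewrite normcM normc_contraction.
have := contraction_le m; have := contraction_gt0 m; have := normc_ge0 (stretch l); nra.
Qed.

Lemma partial_drift_step N m l w : normc l <= 1 ->
  normc (partial_drift N.+1 m l w - partial_drift N m l w) <= (9 / 25) ^+ N * (1 / 10).
Proof.
move=> l1; elim: N m w => [|N IH] m w.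
  by rewrite /= mulr0 addr0 subr0 expr0 mul1r drift_le.
rewrite [partial_drift N.+2 _ _ _]/= -/(partial_drift N.+1 m.+1 l _) [partial_drift N.+1 m l w]/=.
rewrite opprD addrACA subrr add0r -mulrBr normcM exprS -mulrA.
by apply: ler_pM; rewrite ?normc_ge0 ?stretch_contraction_le.
Qed.

Lemma geometric_small (x c : R) : 0 <= x -> x < 1 -> 0 <= c ->
  forall e : R, 0 < e -> exists n, x ^+ n * c <= e.
Proof.
move=> x0 x1 c0 e e0; have := @cvg_geometric R c x; rewrite ger0_norm // => /(_ x1).
move=> /cvgrPdist_le /(_ e e0) [n _ /(_ n (leqnn n))].
rewrite /= sub0r normrN => Hn; exists n; rewrite mulrC; exact: le_trans (ler_norm _) Hn.
Qed.

Lemma partial_drift_cvg m l w : normc l <= 1 ->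
  exists a, ccvg (fun N => partial_drift N m l w) a.
Proof.
move=> l1.
have [] := @ccvg_telescope R (fun N => partial_drift N m l w) (fun n => (9 / 25) ^+ n * (1 / 6)).
- by move=> n; rewrite mulr_ge0 ?exprn_ge0 //; lra.
- by apply: geometric_small; lra.
- move=> n; apply: le_trans (partial_drift_step n m w l1) _; rewrite exprSr.
  have : 0 <= (9 / 25 : R) ^+ n by apply: exprn_ge0; lra.
  by move: (_ ^+ n) => x; lra.
by move=> a [Ha _]; exists a.
Qed.

Definition total_drift m l w : R[i] := clim (fun N => partial_drift N m l w).

Lemma total_drift_cvg m l w : normc l <= 1 -> ccvg (fun N => partial_drift N m l w) (total_drift m l w).
Proof. by move=> l1; apply: ccvg_clim; exact: partial_drift_cvg. Qed.

Lemma total_drift_rec m l w : normc l <= 1 ->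
  total_drift m l w = drift w + stretch l * (contraction m)%:C * total_drift m.+1 l (zoom m w).
Proof.
move=> l1; apply: clim_eq; apply/ccvg_shift; apply: ccvgD; first exact: ccvg_cst.
by apply: ccvgZ; exact: total_drift_cvg.
Qed.

Lemma total_drift2 m l : total_drift m l 2 = 0.
Proof.
apply: clim_eq; rewrite (_ : (fun _ => _) = (fun=> 0)); first exact: ccvg_cst.
by apply/funext => N; exact: partial_drift2.
Qed.

Definition transport m l w : R[i] := w + l * total_drift m l w.

Lemma transport0 m w : transport m 0 w = w.
Proof. by rewrite /transport mul0r addr0. Qed.

(** The self-similarity of the construction: the properties of the motion are
    proved by descending through the generations along this equation. *)
Lemma transport_near m l w : normc l <= 1 -> normc (w - nearest_corner w) <= contraction m ->
  transport m l w = nearest_corner w + stretch l * (contraction m)%:C * transport m.+1 l (zoom m w).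
Proof.
move=> l1 h; rewrite /transport total_drift_rec // drift_near; last exact: le_trans (contraction_le m).
have := zoom_near h.
move: (nearest_corner w) (zoom m w) (total_drift _ _ _) => c y v E; rewrite {}E /stretch; ring.
Qed.

Lemma transport_far m l w : normc l <= 1 -> contraction m < normc (w - nearest_corner w) ->
  transport m l w = flow l w.
Proof.
move=> l1 h; rewrite /transport total_drift_rec // /zoom leNgt h /= total_drift2 mulr0 addr0.
by [].
Qed.

Lemma flow_near m l b c y : normc y <= 1 ->
  flow l (corner R b c + (contraction m)%:C * y) =
  corner R b c + stretch l * (contraction m)%:C * y.
Proof.
move=> y1; set d := corner R b c; set x := d + _.
have xc : normc (x - d) <= contraction m.
  by rewrite /x addrC addKr normcM normc_contraction ler_piMr // ltW // contraction_gt0.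
have cx : nearest_corner x = d.
  by apply: nearest_corner_eq; apply: le_lt_trans xc _; have := contraction_le m; lra.
rewrite /flow drift_near cx; last by apply: le_trans xc _; exact: contraction_le.
by rewrite /x /stretch; ring.
Qed.

(** The zoomed points stay in the unit disc by induction; then [flow] keeps them
    there. *)
Lemma partial_drift_disc N m l w : normc l <= 1 -> normc w <= 1 -> normc (w + l * partial_drift N m l w) <= 1.
Proof.
move=> l1; elim: N m w => [|N IH] m w w1; first by rewrite /= mulr0 addr0.
rewrite /=; case: (leP (normc (w - nearest_corner w)) (contraction m)) => h; last first.
  rewrite /zoom [_ <= contraction m]leNgt h /= partial_drift2 mulr0 addr0; exact: flow_disc.
set y := zoom m w; have y1 := IH m.+1 y (zoom_le1 h).
have -> : w + l * (drift w + stretch l * (contraction m)%:C * partial_drift N m.+1 l y) =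
    flow l (nearest_corner w + (contraction m)%:C * (y + l * partial_drift N m.+1 l y)).
  rewrite (@flow_near m l (0 <= complex.Re w) (0 <= complex.Im w)) //= -/(nearest_corner w).
  rewrite drift_near; last exact: le_trans (contraction_le m).
  have := zoom_near h; rewrite -/y.
  move: (nearest_corner w) y (partial_drift _ _ _ _) {y1 h} => c y v E; rewrite {}E /stretch; ring.
apply: flow_disc => //; apply: le_trans (normc_triangle _ _) _.
rewrite normcM normc_contraction; have := nearest_corner_le w; have := contraction_le m; have := contraction_gt0 m.
have := normc_ge0 (y + l * partial_drift N m.+1 l y); nra.
Qed.

Lemma transport_disc m l w : normc l <= 1 -> normc w <= 1 -> normc (transport m l w) <= 1.
Proof.
move=> l1 w1; rewrite -[transport _ _ _]subr0.
apply: (@ccvg_le _ (fun N => w + l * partial_drift N m l w)).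
  by apply: ccvgD; [exact: ccvg_cst|apply: ccvgZ; exact: total_drift_cvg].
by move=> N; rewrite subr0; exact: partial_drift_disc.
Qed.

(** The motion is [flow] preceded by a map that only moves points inside their own
    discs. Two colliding points therefore have the same shadow, hence lie in the
    same disc or are equal. *)
Definition shadow m l w : R[i] :=
  if normc (w - nearest_corner w) <= contraction m then nearest_corner w + (contraction m)%:C * transport m.+1 l (zoom m w)
  else w.

Lemma transport_shadow m l w : normc l <= 1 -> transport m l w = flow l (shadow m l w).
Proof.
move=> l1; rewrite /shadow; case: (leP _ (contraction m)) => h; last exact: transport_far.
have y1 : normc (transport m.+1 l (zoom m w)) <= 1 by apply: transport_disc => //; exact: zoom_le1.
by rewrite transport_near //; symmetry; exact: flow_near y1.
Qed.

Lemma shadow_near m l w : normc l <= 1 -> normc (w - nearest_corner w) <= contraction m ->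
  nearest_corner (shadow m l w) = nearest_corner w /\ normc (shadow m l w - nearest_corner w) <= contraction m.
Proof.
move=> l1 h; rewrite /shadow h.
have xc : normc (nearest_corner w + (contraction m)%:C * transport m.+1 l (zoom m w) - nearest_corner w) <= contraction m.
  rewrite addrC addKr normcM normc_contraction ler_piMr //; first by rewrite ltW // contraction_gt0.
  by apply: transport_disc => //; exact: zoom_le1.
split=> //; apply: nearest_corner_eq; apply: le_lt_trans xc _; have := contraction_le m; lra.
Qed.

Lemma transport_collision m l z w : normc l < 1 -> z != w -> transport m l z = transport m l w ->
  exists z' w', [/\ z' != w', transport m.+1 l z' = transport m.+1 l w',
    normc (z' - w') <= 2 & z - w = (contraction m)%:C * (z' - w')].
Proof.
move=> l1 zw; have l1' := ltW l1; rewrite !transport_shadow // => /(flow_inj l1).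
case: (leP (normc (z - nearest_corner z)) (contraction m)) => hz;
  case: (leP (normc (w - nearest_corner w)) (contraction m)) => hw E.
- have [cz _] := shadow_near l1' hz; have [cw _] := shadow_near l1' hw.
  have cc : nearest_corner z = nearest_corner w by rewrite -cz E cw.
  exists (zoom m z), (zoom m w).
  have zwE : z - w = (contraction m)%:C * (zoom m z - zoom m w).
    by rewrite {1}(zoom_near hz) {1}(zoom_near hw) cc; ring.
  split=> //.
  + by apply: contra_neq zw => e; apply/eqP; rewrite -subr_eq0 zwE e subrr mulr0.
  + move: E; rewrite /shadow hz hw cc => /addrI /(mulfI (contractionC_neq0 m)) //.
  + apply: le_trans (normc_sub _ _) _.
    by have := zoom_le1 hz; have := zoom_le1 hw; lra.
- exfalso; have [c1 c2] := shadow_near l1' hz; move: c1 c2; rewrite E /shadow.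
  by rewrite leNgt hw /= => <-; lra.
- exfalso; have [c1 c2] := shadow_near l1' hw; move: c1 c2; rewrite -E /shadow.
  by rewrite leNgt hz /= => <-; lra.
- by move: E zw; rewrite /shadow !leNgt hz hw /= => ->; rewrite eqxx.
Qed.

(** Colliding points can be zoomed in upon for ever, so that their distance is at
    most (3/10)^n for every n. *)
Lemma transport_inj m l : normc l < 1 -> injective (transport m l).
Proof.
move=> l1 z w E; apply/eqP; apply: contraT => zw.
have key n : forall m z w, z != w -> transport m l z = transport m l w ->
    normc (z - w) <= (3 / 10) ^+ n.
  elim: n => [|n IH] {E zw} m' x y xy E.
    have [x' [y' [_ _ h ->]]] := transport_collision l1 xy E.
    rewrite expr0 normcM normc_contraction.
    have := contraction_le m'; have := contraction_gt0 m'; have := normc_ge0 (x' - y'); nra.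
  have [x' [y' [xy' E' _ ->]]] := transport_collision l1 xy E.
  rewrite normcM normc_contraction exprS; apply: ler_pM; rewrite ?normc_ge0 ?contraction_le //.
    by rewrite ltW // contraction_gt0.
  exact: IH E'.
have zw0 : 0 < normc (z - w) / 2 by rewrite divr_gt0 // normc_gt0 subr_eq0.
have x0 : 0 <= 3 / 10 :> R by lra.
have x1 : 3 / 10 < 1 :> R by lra.
have [n] := geometric_small x0 x1 ler01 zw0.
by rewrite mulr1; have := key n _ _ _ zw E; lra.
Qed.

(** The derivative of [partial_drift] with respect to l. *)
Fixpoint partial_drift_slope N m l w : R[i] :=
  if N is N'.+1 then (contraction m)%:C *
    ((1 / 5)%:C * partial_drift N' m.+1 l (zoom m w) + stretch l * partial_drift_slope N' m.+1 l (zoom m w)) else 0.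

Lemma partial_drift_le N m l w : normc l <= 1 -> normc (partial_drift N m l w) <= 1 / 6.
Proof.
move=> l1; elim: N m w => [|N IH] m w; first by rewrite [partial_drift _ _ _ _]/= normc0; lra.
rewrite [partial_drift N.+1 _ _ _]/=.
apply: le_trans (normc_triangle _ _) _; rewrite (normcM (stretch l * _)).
have := ler_pM (normc_ge0 _) (normc_ge0 _) (stretch_contraction_le m l1) (IH m.+1 (zoom m w)).
have := drift_le w; lra.
Qed.

Lemma partial_drift_lip N m l l0 w : normc l <= 1 -> normc l0 <= 1 ->
  normc (partial_drift N m l w - partial_drift N m l0 w) <= normc (l - l0).
Proof.
move=> l1 l01; elim: N m w => [|N IH] m w; first by rewrite subrr normc0 normc_ge0.
rewrite ![partial_drift N.+1 _ _ _]/=.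
set x := zoom m w; set S := partial_drift N m.+1 l x; set S0 := partial_drift N m.+1 l0 x.
rewrite (_ : _ - _ = (stretch l0 * (contraction m)%:C) * (S - S0)
    + ((contraction m)%:C * (1 / 5)%:C) * (l - l0) * S); last by rewrite /stretch; ring.
apply: le_trans (normc_triangle _ _) _; rewrite !normcM normc_contraction fifth_norm.
have := stretch_contraction_le m l01; rewrite normcM normc_contraction.
have := IH m.+1 x; rewrite -/S -/S0; have := partial_drift_le N m.+1 x l1; rewrite -/S.
have := contraction_le m; have := contraction_gt0 m; have := normc_ge0 (l - l0).
have := normc_ge0 S; have := normc_ge0 (S - S0); have := normc_ge0 (stretch l0).
move: (normc _) (normc S) (normc (l - l0)) (normc (S - S0)) (contraction m) => a b c d r.
move=> a0 d0 b0 c0 r0 r3 b6 dc ar.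
have h1 : a * r * d <= 9 / 25 * c by apply: ler_pM => //; rewrite mulr_ge0 // ltW.
have h2 : c * b <= c * (1 / 6) by apply: ler_wpM2l.
have h3 : r * (c * b) <= 3 / 10 * (c * b) by apply: ler_wpM2r => //; exact: mulr_ge0.
lra.
Qed.

Lemma partial_drift_taylor N m l l0 w : normc l <= 1 -> normc l0 <= 1 ->
  normc (partial_drift N m l w - partial_drift N m l0 w - (l - l0) * partial_drift_slope N m l0 w) <= normc (l - l0) ^+ 2.
Proof.
move=> l1 l01; elim: N m w => [|N IH] m w.
  by rewrite ![partial_drift 0 _ _ _]/= [partial_drift_slope 0 _ _ _]/= mulr0 !subr0 normc0 sqr_ge0.
rewrite ![partial_drift N.+1 _ _ _]/= [partial_drift_slope N.+1 _ _ _]/=.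
set x := zoom m w; set S := partial_drift N m.+1 l x; set S0 := partial_drift N m.+1 l0 x.
set D := partial_drift_slope _ _ _ _.
rewrite (_ : _ - _ - _ = (stretch l0 * (contraction m)%:C) * (S - S0 - (l - l0) * D)
    + ((contraction m)%:C * (1 / 5)%:C) * (l - l0) * (S - S0)); last by rewrite /stretch; ring.
apply: le_trans (normc_triangle _ _) _; rewrite !normcM normc_contraction fifth_norm.
have := stretch_contraction_le m l01; rewrite normcM normc_contraction.
have := IH m.+1 x; rewrite -/S -/S0 -/D; have := partial_drift_lip N m.+1 x l1 l01; rewrite -/S -/S0.
have := contraction_le m; have := contraction_gt0 m; have := normc_ge0 (l - l0).
have := normc_ge0 (S - S0 - (l - l0) * D); have := normc_ge0 (S - S0).
have := normc_ge0 (stretch l0).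
move: (normc _) (normc (l - l0)) (normc (S - S0 - _)) (normc (S - S0)) (contraction m) => a c d b r.
move=> a0 b0 d0 c0 r0 r3 bc dc ar.
have h1 : a * r * d <= 9 / 25 * c ^+ 2 by apply: ler_pM => //; rewrite mulr_ge0 // ltW.
have h2 : c * b <= c * c by apply: ler_wpM2l.
have h3 : r * (c * b) <= 3 / 10 * (c * b) by apply: ler_wpM2r => //; exact: mulr_ge0.
have := sqr_ge0 c; rewrite !expr2 in h1 *; lra.
Qed.

Lemma transport_cdiff m w l0 : normc l0 < 1 -> cdiff (fun l => transport m l w) l0.
Proof.
move=> l01; have r0 : 0 < 1 - normc l0 by lra.
have near l : normc (l - l0) < 1 - normc l0 -> normc l <= 1.
  by move=> h; have := normc_triangle (l - l0) l0; rewrite subrK; lra.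
apply: (@cdiff_lim R (fun N l => w + l * partial_drift N m l w) _ l0
  (fun N => partial_drift N m l0 w + l0 * partial_drift_slope N m l0 w) _ 2 r0).
  move=> l /near l1; apply: ccvgD; first exact: ccvg_cst.
  by apply: ccvgZ; exact: total_drift_cvg.
move=> N l /near l1; have l01' := ltW l01.
rewrite (_ : _ - _ - _ = l0 * (partial_drift N m l w - partial_drift N m l0 w - (l - l0) * partial_drift_slope N m l0 w)
   + (l - l0) * (partial_drift N m l w - partial_drift N m l0 w)); last by ring.
apply: le_trans (normc_triangle _ _) _; rewrite !normcM.
have h1 := ler_pM (normc_ge0 l0) (normc_ge0 _) (ltW l01) (partial_drift_taylor N m w l1 l01').
have h2 := ler_wpM2l (normc_ge0 (l - l0)) (partial_drift_lip N m w l1 l01').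
rewrite mul1r in h1; rewrite expr2 in h1 *; lra.
Qed.

(** For a real dilation factor, the moved Cantor set is covered by the discs of
    the four-corner construction with the dilated ratios. *)
Lemma transport_cantor_cover l a N m p s p' s' w : normc l <= 1 -> stretch l = a%:C -> 0 < a ->
  0 < s -> 0 < s' -> cantor_cover contraction N m p s (p + s%:C * w) ->
  cantor_cover (fun i => a * contraction i) N m p' s' (p' + s'%:C * transport m l w).
Proof.
move=> l1 la a0; elim: N m p s p' s' w => [|N IH] m p s p' s' w s0 s0' /=.
  rewrite !(addrC p) !(addrC p') !addrK !normcM !normcR !gtr0_norm //.
  rewrite !ger_pMr //; exact: transport_disc.
move=> [b [c H]]; exists b, c.
have := cantor_cover_le contraction_gt0 contraction_le (mulr_gt0 s0 (contraction_gt0 m)) H.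
rewrite (_ : _ - _ = s%:C * (w - corner R b c)); last by ring.
rewrite normcM normcR gtr0_norm // ler_pM2l // => h.
have cw : nearest_corner w = corner R b c.
  by apply: nearest_corner_eq; apply: le_lt_trans h _; have := contraction_le m; lra.
rewrite -cw in h H *.
have -> : p' + s'%:C * transport m l w =
   (p' + s'%:C * nearest_corner w) + (s' * (a * contraction m))%:C * transport m.+1 l (zoom m w).
  by rewrite transport_near // la !rmorphM /=; ring.
apply: (IH _ (p + s%:C * nearest_corner w) (s * contraction m)).
- by rewrite mulr_gt0 ?contraction_gt0.
- by rewrite !mulr_gt0 ?contraction_gt0.
suff -> : p + s%:C * nearest_corner w + (s * contraction m)%:C * zoom m w = p + s%:C * w by [].
have -> : (s * contraction m)%:C = s%:C * (contraction m)%:C by exact: rmorphM.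
by rewrite [in RHS](zoom_near h); ring.
Qed.

End Motion.

(** * Cauchy transform of the Cantor measure: increments *)

Section Potential.
Variable R : realType.
Implicit Types (s t : R) (z w l p : R[i]).
Local Notation contraction := (@contraction R).
Local Notation corner := (@corner R).

(** The function 1/z, truncated inside the unit disc so as to be bounded and
    Lipschitz: the Cauchy transform of a unit mass spread over the unit circle,
    up to its values inside. *)
Definition capped_inv z : R[i] := conjc z / (Num.max 1 (normc z) ^+ 2)%:C.

Lemma normc_conjc z : normc (conjc z) = normc z.
Proof. by case: z => x y /=; rewrite sqrrN. Qed.

Lemma max1_ge z : 1 <= Num.max 1 (normc z) /\ normc z <= Num.max 1 (normc z).
Proof. by rewrite !le_max !lexx orbT. Qed.

Lemma normc_max1 z n : normc ((Num.max 1 (normc z) ^+ n)%:C : R[i]) = Num.max 1 (normc z) ^+ n.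
Proof.
have [t1 _] := max1_ge z.
by rewrite normcR ger0_norm // exprn_ge0 //; lra.
Qed.

Lemma capped_inv_le z : normc (capped_inv z) <= 1.
Proof.
have [t1 tz] := max1_ge z; rewrite /capped_inv normcM normcV normc_max1 normc_conjc.
move: t1 tz; set t := Num.max _ _ => t1 tz.
rewrite ler_pdivrMr ?mul1r; last by rewrite exprn_gt0 //; lra.
by apply: le_trans tz _; rewrite expr2; nra.
Qed.

Lemma capped_inv_far z : 1 <= normc z -> capped_inv z = z^-1.
Proof.
move=> z1; rewrite /capped_inv (max_idPr z1).
have z0 : z != 0 by rewrite -normc_gt0; lra.
have E : (normc z ^+ 2)%:C = z * conjc z.
  by rewrite -sqr_normc normrcE rmorphXn.
have z0' : conjc z != 0 by rewrite conjc_eq0.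
by rewrite E; field; rewrite z0.
Qed.

(** With M and m the truncated norms, the difference of the factors M^-2 and m^-2
    is (M - m)(M + m)/(Mm)^2 up to sign, and (M + m) |w| <= 2 (Mm)^2. *)
Lemma capped_inv_lip z w : normc (capped_inv z - capped_inv w) <= 3 * normc (z - w).
Proof.
have [M1 Mz] := max1_ge z; have [m1 mw] := max1_ge w.
have Mm : `|Num.max 1 (normc z) - Num.max 1 (normc w)| <= normc (z - w).
  have h1 := normc_distl z w.
  have h2 : normc w - normc z <= normc (z - w) by rewrite normcB normc_distl.
  have h3 := normc_ge0 (z - w).
  by rewrite ler_norml; case: (lerP 1 (normc z)) => hz; case: (lerP 1 (normc w)) => hw; lra.
rewrite /capped_inv; move: M1 Mz m1 mw Mm.
set M := Num.max _ _; set m := Num.max 1 _ => M1 Mz m1 mw Mm.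
have M0 : 0 < M by lra. have m0 : 0 < m by lra.
have Mc : M%:C != 0 by rewrite complexR_eq0 gt_eqF.
have mc : m%:C != 0 by rewrite complexR_eq0 gt_eqF.
rewrite !rmorphXn /=.
rewrite (_ : _ - _ = conjc (z - w) / M%:C ^+ 2 - conjc w * ((M - m) * (M + m) / (M ^+ 2 * m ^+ 2))%:C).
  apply: le_trans (normc_sub _ _) _; rewrite !normcM normcV normcX !normcR !normc_conjc.
  have Mm0 : 0 < M + m by lra.
  have Mm2 : 0 < M ^+ 2 * m ^+ 2 by rewrite mulr_gt0 ?exprn_gt0.
  rewrite (gtr0_norm M0) normrM normrM normfV (gtr0_norm Mm0) (gtr0_norm Mm2).
  have d0 := normc_ge0 (z - w).
  have b1 : normc (z - w) / M ^+ 2 <= normc (z - w).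
    by rewrite ler_pdivrMr ?exprn_gt0 // ler_peMr // expr2; nra.
  have b2 : normc w * (`|M - m| * (M + m) / (M ^+ 2 * m ^+ 2)) <= 2 * normc (z - w).
    have c1 : normc w * (M + m) <= 2 * (M ^+ 2 * m ^+ 2).
      apply: (@le_trans _ _ (m * (M + m))); first by apply: ler_wpM2r => //; lra.
      have : m * (M + m) <= m * (2 * (M * m)) by apply: ler_wpM2l; nra.
      have : (M * m) * m <= (M * m) * (M * m) by apply: ler_wpM2l; nra.
      rewrite !expr2; nra.
    rewrite mulrA ler_pdivrMr; last by rewrite mulr_gt0 ?exprn_gt0.
    rewrite mulrCA [2 * _]mulrC -mulrA; apply: ler_pM => //.
    by rewrite mulr_ge0 ?normc_ge0 //; lra.
  lra.
rewrite rmorphB /= !rmorphM fmorphV rmorphB rmorphD rmorphM !rmorphXn /=.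
by field; rewrite Mc mc.
Qed.

Definition corner_mean (F : R[i] -> R[i]) : R[i] :=
  (1 / 4)%:C * (F (corner false false) + F (corner false true)
   + (F (corner true false) + F (corner true true))).

Lemma corner_meanB F G : corner_mean F - corner_mean G = corner_mean (fun c => F c - G c).
Proof. by rewrite /corner_mean; cbv beta; ring. Qed.

Lemma quarter_norm : normc ((1 / 4)%:C : R[i]) = 1 / 4.
Proof. by rewrite normcR ger0_norm //; lra. Qed.

Lemma corner_mean_sum_le F (B : bool -> bool -> R) :
  (forall b c, normc (F (corner b c)) <= B b c) ->
  normc (corner_mean F) <= (B false false + B false true + (B true false + B true true)) / 4.
Proof.
move=> H; rewrite /corner_mean normcM quarter_norm.
have := normc_triangle (F (corner false false) + F (corner false true))
  (F (corner true false) + F (corner true true)).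
have := normc_triangle (F (corner false false)) (F (corner false true)).
have := normc_triangle (F (corner true false)) (F (corner true true)).
have := H false false; have := H false true; have := H true false; have := H true true.
lra.
Qed.

Lemma corner_mean_le F M : (forall b c, normc (F (corner b c)) <= M) -> normc (corner_mean F) <= M.
Proof. by move=> /corner_mean_sum_le h; apply: le_trans h _; lra. Qed.

(** At most one corner is at distance less than 2/5 from z. *)
Lemma corner_mean_le_one F z A B : 
  (forall b c, normc (F (corner b c)) <= A) ->
  (forall b c, 2 / 5 <= normc (z - corner b c) -> normc (F (corner b c)) <= B) ->
  0 <= B -> normc (corner_mean F) <= (A + 3 * B) / 4.
Proof.
move=> HA HB B0; pose b0 := 0 <= complex.Re z; pose c0 := 0 <= complex.Im z.
have A0 : 0 <= A := le_trans (normc_ge0 _) (HA false false).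
have H b c : normc (F (corner b c)) <= if (b == b0) && (c == c0) then A else B.
  case: ifP => [_|ne]; first exact: HA.
  apply: HB; rewrite leNgt; apply/negP => /nearest_corner_eq; rewrite /nearest_corner -/b0 -/c0.
  case=> e1 e2; move: ne e1 e2.
  by case: b; case: c; case: b0; case: c0 => //= _ e1 e2; lra.
by move: (corner_mean_sum_le H) => {H} h; apply: le_trans h _; case: b0; case: c0 => /=; lra.
Qed.

(** The radius l_N of a generation-N disc inside a unit disc of index [m]. *)
Fixpoint block_size N m : R := if N is N'.+1 then contraction m * block_size N' m.+1 else 1.

Lemma block_sizeE N m : block_size N m = \prod_(i < N) contraction (m + i).
Proof.
elim: N m => [|N IH] m; first by rewrite big_ord0.
rewrite big_ord_recl addn0 [LHS]/= IH; congr (_ * _).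
by apply: eq_bigr => i _; rewrite lift0 addnS.
Qed.

Lemma block_size_gt0 N m : 0 < block_size N m.
Proof. by elim: N m => [|N IH] m //=; rewrite mulr_gt0 // contraction_gt0. Qed.

Lemma block_size_le N m : block_size N m <= (3 / 10) ^+ N.
Proof.
elim: N m => [|N IH] m //=; rewrite exprS; apply: ler_pM => //.
- by rewrite ltW // contraction_gt0.
- by rewrite ltW // block_size_gt0.
- exact: contraction_le.
Qed.

Definition rescale m z c : R[i] := (z - c) / (contraction m)%:C.

(** The mean over the 4^N discs of generation N of 1/(z - c), truncated inside the
    respective disc: the N-th approximation to the Cauchy transform. *)
Fixpoint approx_pot N m z : R[i] :=
  if N is N'.+1 then (contraction m)%:C^-1 * corner_mean (fun c => approx_pot N' m.+1 (rescale m z c))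
  else capped_inv z.

Lemma normc_rescale m z c : normc (rescale m z c) = normc (z - c) / contraction m.
Proof. by rewrite normcM normcV normc_contraction. Qed.

Lemma rescale_far m z b c : (normc z - 1) / contraction m <= normc (rescale m z (corner b c)) - 1.
Proof.
rewrite normc_rescale ler_pdivrMr ?contraction_gt0 // mulrBl divfK ?gt_eqF ?contraction_gt0 //.
have := contraction_le R m; have := corner_le R b c; have := normc_distl z (corner b c).
lra.
Qed.

Lemma rescale_gt1 m z b c : 1 < normc z -> 1 < normc (rescale m z (corner b c)).
Proof.
move=> z1; have := rescale_far m z b c.
have : 0 < (normc z - 1) / contraction m by rewrite divr_gt0 ?contraction_gt0 // subr_gt0.
lra.
Qed.

Lemma normc_contractionV m : normc ((contraction m)%:C^-1) = (contraction m)^-1.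
Proof. by rewrite normcV normc_contraction. Qed.

Lemma approx_pot_step N m z : approx_pot N.+2 m z - approx_pot N.+1 m z =
  (contraction m)%:C^-1 * corner_mean (fun c => approx_pot N.+1 m.+1 (rescale m z c) - approx_pot N m.+1 (rescale m z c)).
Proof.
rewrite [approx_pot N.+2 _ _]/= -/(approx_pot N.+1 m.+1) [approx_pot N.+1 m z]/=.
by rewrite -mulrBr corner_meanB.
Qed.

(** The means of 1/(z - c) over the corners and 1/z differ by O(|z|^-2); the bound
    l_N/(|z| - 1)^2 is the form of this that is preserved by rescaling. *)
Lemma approx_pot_diff_far N m z : 1 < normc z ->
  normc (approx_pot N.+1 m z - approx_pot N m z) <= block_size N m / (normc z - 1) ^+ 2.
Proof.
elim: N m z => [|N IH] m z z1.
  have z0 : z != 0 by rewrite -normc_gt0; lra.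
  rewrite /= capped_inv_far; last by lra.
  have rc b c : capped_inv (rescale m z (corner b c)) = (contraction m)%:C / (z - corner b c).
    by rewrite capped_inv_far ?invf_div // ltW // rescale_gt1.
  rewrite (_ : _ - _ = corner_mean (fun c => c / (z * (z - c)))).
    apply: corner_mean_le => b c; rewrite normcM normcV normcM.
    have h1 := corner_le R b c; have h2 := normc_distl z (corner b c).
    have h3 : 0 < (normc z - 1) ^+ 2 by rewrite exprn_gt0 // subr_gt0.
    have h4 := normc_ge0 (corner b c).
    apply: ler_pM => //; first by rewrite invr_ge0 mulr_ge0 ?normc_ge0.
      by apply: le_trans h1 _; lra.
    rewrite lef_pV2 ?posrE // ?mulr_gt0 //; try lra.
    by rewrite expr2; apply: ler_pM; lra.
  rewrite /corner_mean !rc.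
  have d b c : z - corner b c != 0.
    rewrite -normc_gt0; have h1 := corner_le R b c; have h2 := normc_distl z (corner b c).
    lra.
  have r0 := contractionC_neq0 R m.
  rewrite (_ : (1 / 4)%:C = 4^-1); last by rewrite mul1r fmorphV rmorphMn rmorph1.
  by field; rewrite z0 r0 !d.
rewrite approx_pot_step normcM normc_contractionV.
have r0 := contraction_gt0 R m; have z10 : 0 < normc z - 1 by rewrite subr_gt0.
rewrite ler_pdivrMl //.
have -> : contraction m * (block_size N.+1 m / (normc z - 1) ^+ 2) =
    block_size N m.+1 * contraction m ^+ 2 / (normc z - 1) ^+ 2.
  by rewrite [block_size N.+1 m]/=; field; rewrite gt_eqF.
apply: corner_mean_le => b c; apply: le_trans (IH m.+1 _ (rescale_gt1 m b c z1)) _.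
rewrite ler_pdivrMr; last by rewrite exprn_gt0 // subr_gt0 rescale_gt1.
have h : (normc z - 1) ^+ 2 <= (contraction m) ^+ 2 * (normc (rescale m z (corner b c)) - 1) ^+ 2.
  have y1 := rescale_gt1 m b c z1.
  rewrite -exprMn ler_pXn2r ?nnegrE //; first by rewrite -ler_pdivrMl // mulrC rescale_far.
  - by lra.
  - by rewrite mulr_ge0 //; lra.
have s0 := block_size_gt0 N m.+1.
rewrite mulrAC ler_pdivlMr ?exprn_gt0 // -[leRHS]mulrA ler_pM2l //.
Qed.

End Potential.

(** * Cauchy transform of the Cantor measure: the limit *)

Section PotentialLimit.
Variable R : realType.
Implicit Types (s t : R) (z w l p : R[i]).
Local Notation contraction := (@contraction R).
Local Notation corner := (@corner R).
Local Notation block_size := (@block_size R).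

(** In the recursion at most one of the four corners is near z, and the other three
    contribute at most 9 l_N each by [approx_pot_diff_far]. The increase of the
    numerator is thus at most 27 * 4^N l_N^2 <= 27 (9/25)^N, and 45 is chosen so
    that 45 (1 - 9/25) exceeds 27. *)
Lemma approx_pot_diff_near N m z :
  normc (approx_pot N.+1 m z - approx_pot N m z) <=
  (50 - 45 * (9 / 25) ^+ N) / (4 ^+ N * block_size N m).
Proof.
elim: N m z => [|N IH] m z.
  have -> : (50 - 45 * (9 / 25) ^+ 0) / (4 ^+ 0 * block_size 0 m) = 5.
    by rewrite [block_size _ _]/= !expr0; field.
  have r4 := contraction_ge R m; have r0 := contraction_gt0 R m; rewrite [approx_pot _ _ _]/= [approx_pot 0 _ _]/=.
  apply: le_trans (normc_sub _ _) _; have := capped_inv_le z.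
  rewrite (normcM (contraction m)%:C^-1) normc_contractionV.
  have : normc (corner_mean (fun c => capped_inv (rescale m z c))) <= 1.
    by apply: corner_mean_le => b c; exact: capped_inv_le.
  have : (contraction m)^-1 <= 4 by rewrite -[4]invrK lef_pV2 ?posrE ?invr_gt0 //; lra.
  have := normc_ge0 (corner_mean (fun c => capped_inv (rescale m z c))).
  have : 0 < (contraction m)^-1 by rewrite invr_gt0.
  move: (_^-1) (normc _) (normc _) => x y u; nra.
rewrite approx_pot_step normcM normc_contractionV.
have r0 := contraction_gt0 R m; have r3 := contraction_le R m; have s0 := block_size_gt0 R N m.+1.
have p0 : 0 < (4 : R) ^+ N by rewrite exprn_gt0.
have B0 : 0 <= 9 * block_size N m.+1 by lra.
have far b c : 2 / 5 <= normc (z - corner b c) ->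
    normc (approx_pot N.+1 m.+1 (rescale m z (corner b c)) - approx_pot N m.+1 (rescale m z (corner b c)))
      <= 9 * block_size N m.+1.
  move=> h.
  have y43 : 4 / 3 <= normc (rescale m z (corner b c)).
    by rewrite normc_rescale ler_pdivlMr //; lra.
  apply: le_trans (approx_pot_diff_far _ _ _) _; first by lra.
  rewrite ler_pdivrMr; last by rewrite exprn_gt0 //; lra.
  rewrite [9 * _]mulrC -mulrA ler_peMr; [by []|exact: ltW|].
  by move: (normc _) y43 => y y43; rewrite expr2; nra.
rewrite ler_pdivrMl //.
apply: le_trans (corner_mean_le_one (fun b c => IH m.+1 (rescale m z (corner b c))) far B0) _.
have sc : 4 ^+ N * (block_size N m.+1 * block_size N m.+1) <= (9 / 25) ^+ N.
  apply: (@le_trans _ _ (4 ^+ N * ((3 / 10) ^+ N * (3 / 10) ^+ N))).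
    by rewrite ler_pM2l //; apply: ler_pM; rewrite ?block_size_le // ltW.
  by rewrite -!exprMn (_ : 4 * _ = 9 / 25) //; field.
rewrite [block_size N.+1 m]/= !exprS.
move: sc p0 s0 {IH far B0}; move: (4 ^+ N) (block_size N m.+1) ((9 / 25) ^+ N) => p s q sc p0 s0.
have -> : contraction m * ((50 - 45 * (9 / 25 * q)) / (4 * p * (contraction m * s))) =
   (50 - 45 * (9 / 25 * q)) / (p * s) / 4.
  by field; rewrite !gt_eqF.
rewrite ler_pM2r ?invr_gt0 // -lerBrDl -mulrBl ler_pdivlMr ?mulr_gt0 //.
have -> : 3 * (9 * s) * (p * s) = 27 * (p * (s * s)) by ring.
have : 0 <= p * (s * s) by rewrite mulr_ge0 ?mulr_ge0 // ltW.
lra.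
Qed.

Lemma approx_pot_diff N m z :
  normc (approx_pot N.+1 m z - approx_pot N m z) <=
  50 * (m%:R + 11) ^+ 2 * ((m + N)%:R + 11) ^- 2.
Proof.
apply: le_trans (approx_pot_diff_near N m z) _.
rewrite block_sizeE prod_contraction (expr_div_n (_ + 11)) invf_div mulrA.
have h : 0 <= (9 / 25 : R) ^+ N by apply: exprn_ge0; lra.
rewrite ler_pM2r; last first.
  by rewrite invr_gt0 exprn_gt0 //; have := ler0n R (m + N); lra.
rewrite ler_wpM2r ?sqr_ge0 //; lra.
Qed.

(** 1/(k + 11)^2 is at most 1/(k + 10) - 1/(k + 11), which makes the bound of
    [approx_pot_diff] telescope. *)
Definition tail_bound m N : R := 50 * (m%:R + 11) ^+ 2 / ((m + N)%:R + 10).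

Lemma tail_bound_ge0 m N : 0 <= tail_bound m N.
Proof.
rewrite /tail_bound mulr_ge0 ?mulr_ge0 ?sqr_ge0 // invr_ge0.
Qed.

Lemma tail_bound_small m (e : R) : 0 < e -> exists N, tail_bound m N <= e.
Proof.
move=> e0; set K : R := 50 * (m%:R + 11) ^+ 2.
have K0 : 0 <= K by rewrite /K mulr_ge0 ?sqr_ge0.
exists (Num.truncn (K / e)).+1; rewrite /tail_bound -/K.
have n0 := ler0n R (m + (Num.truncn (K / e)).+1).
rewrite ler_pdivrMr; last by lra.
rewrite mulrC -ler_pdivrMr //; apply: ltW; apply: lt_le_trans (truncnS_gt _) _.
by rewrite natrD; have := ler0n R m; lra.
Qed.

Lemma approx_pot_telescope N m z :
  normc (approx_pot N.+1 m z - approx_pot N m z) <= tail_bound m N - tail_bound m N.+1.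
Proof.
apply: le_trans (approx_pot_diff N m z) _; rewrite /tail_bound -mulrBr -!mulrA ler_pM2l //.
rewrite ler_wpM2l ?sqr_ge0 // addnS -(natr1 (m + N)%N).
have := ler0n R (m + N); move: ((m + N)%:R) => x x0.
rewrite (_ : _ - _ = ((x + 10) * (x + 11))^-1); last first.
  by field; apply/andP; split; apply/eqP; lra.
have m0 := ler0n R m; apply: ler_wpM2l; first by lra.
rewrite lef_pV2 ?posrE ?exprn_gt0 ?mulr_gt0 //; try lra.
Qed.

Definition potential m z : R[i] := clim (fun N => approx_pot N m z).

Lemma potential_cvg m z : ccvg (fun N => approx_pot N m z) (potential m z).
Proof.
apply: ccvg_clim.
have [l [H _]] := ccvg_telescope (tail_bound_ge0 m) (@tail_bound_small m) (fun N => approx_pot_telescope N m z).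
by exists l.
Qed.

Lemma potential_tail m z N : normc (potential m z - approx_pot N m z) <= tail_bound m N.
Proof.
have [l [H Hl]] := ccvg_telescope (tail_bound_ge0 m) (@tail_bound_small m) (fun N => approx_pot_telescope N m z).
by rewrite (ccvg_unique (potential_cvg m z) H).
Qed.

(** The first approximation is at most 1 and the tail is 605. *)
Lemma potential_bound z : normc (potential 0 z) <= 606.
Proof.
have := potential_tail 0 z 0; rewrite /tail_bound addn0 /= => h.
have := capped_inv_le z; have := normc_distl (potential 0 z) (capped_inv z).
have : 50 * (0 + 11) ^+ 2 / (0 + 10) = 605 :> R by field.
lra.
Qed.

Lemma potential_rec m z : potential m z = (contraction m)%:C^-1 * corner_mean (fun c => potential m.+1 (rescale m z c)).
Proof.
apply: clim_eq; apply/ccvg_shift; apply: ccvgZ; rewrite /corner_mean.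
by apply: ccvgZ; apply: ccvgD; apply: ccvgD; exact: potential_cvg.
Qed.

Lemma fcont_affine (f : R[i] -> R[i]) (p k z : R[i]) :
  fcont f ((z - p) / k) -> fcont (fun w => f ((w - p) / k)) z.
Proof.
move=> H e /H [del del0 Hd]; pose K := 1 + normc k^-1.
have K0 : 0 < K by rewrite /K; have := normc_ge0 k^-1; lra.
exists (del / K); first exact: divr_gt0.
move=> w wz; apply: Hd; rewrite -mulrBl normcM.
rewrite (_ : w - p - (z - p) = w - z); last by ring.
move: wz; rewrite ltr_pdivlMr // /K; have := normc_ge0 (w - z).
by have := normc_ge0 k^-1; nra.
Qed.

Lemma fcont_corner_mean (F : R[i] -> R[i] -> R[i]) z :
  (forall b c, fcont (F (corner b c)) z) -> fcont (fun w => corner_mean (F^~ w)) z.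
Proof.
move=> H; apply: (@fcontZ _ (1 / 4)%:C).
by apply: fcontD; apply: fcontD; exact: H.
Qed.

Lemma approx_pot_fcont N m z : fcont (approx_pot N m) z.
Proof.
elim: N m z => [|N IH] m z; first by apply: (@fcont_lip _ _ _ 3) => w; exact: capped_inv_lip.
apply: (@fcontZ _ (contraction m)%:C^-1 (fun w => corner_mean (fun c => approx_pot N m.+1 (rescale m w c)))).
apply: (@fcont_corner_mean (fun c w => approx_pot N m.+1 (rescale m w c))) => b c.
exact: fcont_affine.
Qed.

Lemma potential_fcont m z : fcont (potential m) z.
Proof.
move=> e e0; have e3 : 0 < e / 3 by rewrite divr_gt0.
have [N HN] := tail_bound_small m e3; have [del del0 H] := @approx_pot_fcont N m z _ e3.
exists del => // w /H wz.
rewrite (_ : potential m w - potential m z = (potential m w - approx_pot N m w) + (approx_pot N m w - approx_pot N m z)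
  - (potential m z - approx_pot N m z)); last by ring.
apply: le_trans (normc_sub _ _) _.
have := normc_triangle (potential m w - approx_pot N m w) (approx_pot N m w - approx_pot N m z).
have := potential_tail m w N; have := potential_tail m z N; lra.
Qed.

Lemma approx_pot_inv N m z : 1 < normc z ->
  normc (approx_pot N m z - z^-1) <= 2 * (1 - (3 / 10) ^+ N) / (normc z - 1) ^+ 2.
Proof.
move=> z1; elim: N => [|N IH].
  rewrite [approx_pot _ _ _]/= capped_inv_far; last exact: ltW.
  by rewrite subrr normc0 expr0 subrr mulr0 mul0r.
rewrite (_ : _ - _ = (approx_pot N.+1 m z - approx_pot N m z) + (approx_pot N m z - z^-1)); last by ring.
apply: le_trans (normc_triangle _ _) _; have := approx_pot_diff_far N m z1; move: IH.
have : 0 < (normc z - 1) ^- 2 by rewrite invr_gt0 exprn_gt0 // subr_gt0.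
have : 0 <= (3 / 10 : R) ^+ N by apply: exprn_ge0; lra.
have := block_size_le R N m; rewrite (exprS (3 / 10 : R) N); move: (block_size N m) => s.
move: (_ ^- 2) (_ ^+ N) => c u su u0 c0 h1 h2.
have h3 : s * c <= u * c by rewrite ler_pM2r.
have h4 : 0 <= u * c by rewrite mulr_ge0 // ltW.
lra.
Qed.

Lemma potential_inv m z : 1 < normc z -> normc (potential m z - z^-1) <= 2 / (normc z - 1) ^+ 2.
Proof.
move=> z1; apply: (ccvg_le (potential_cvg m z)) => N; apply: le_trans (approx_pot_inv N m z1) _.
rewrite ler_pM2r ?invr_gt0 ?exprn_gt0 ?subr_gt0 //.
by have : 0 <= (3 / 10 : R) ^+ N by [apply: exprn_ge0; lra]; lra.
Qed.

(** The derivative of [approx_pot] off the closed unit disc. *)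
Fixpoint approx_pot_slope N m z : R[i] :=
  if N is N'.+1 then
    (contraction m)%:C^-1 * ((contraction m)%:C^-1 * corner_mean (fun c => approx_pot_slope N' m.+1 (rescale m z c)))
  else - z^-1 ^+ 2.

(** The right-hand side scales in the same way as the left-hand side under
    rescaling, so that only the case of 1/z requires a computation. *)
Lemma approx_pot_taylor N m z z0 : 1 < normc z -> 1 < normc z0 ->
  normc (approx_pot N m z - approx_pot N m z0 - (z - z0) * approx_pot_slope N m z0) <=
  normc (z - z0) ^+ 2 / ((normc z - 1) * (normc z0 - 1) ^+ 2).
Proof.
elim: N m z z0 => [|N IH] m z z0 z1 z01.
  have zn : z != 0 by rewrite -normc_gt0; lra.
  have z0n : z0 != 0 by rewrite -normc_gt0; lra.
  rewrite [approx_pot _ _ _]/= [approx_pot 0 _ z0]/= [approx_pot_slope _ _ _]/= !capped_inv_far; try exact: ltW.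
  rewrite (_ : _ - _ - _ = (z - z0) ^+ 2 / (z * z0 ^+ 2)); last by field; rewrite zn z0n.
  rewrite (normcM ((z - z0) ^+ 2)) normcV (normcM z) !normcX; apply: ler_wpM2l; first exact: sqr_ge0.
  rewrite lef_pV2 ?posrE; last 2 first.
  - by rewrite mulr_gt0 ?exprn_gt0 //; lra.
  - by rewrite mulr_gt0 ?exprn_gt0 // subr_gt0.
  by apply: ler_pM; rewrite ?exprn_ge0 ?ler_pXn2r ?nnegrE //; lra.
have r0 := contraction_gt0 R m; have rn := contractionC_neq0 R m.
have -> : approx_pot N.+1 m z - approx_pot N.+1 m z0 - (z - z0) * approx_pot_slope N.+1 m z0 =
  (contraction m)%:C^-1 * corner_mean (fun c => approx_pot N m.+1 (rescale m z c) - approx_pot N m.+1 (rescale m z0 c)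
     - (rescale m z c - rescale m z0 c) * approx_pot_slope N m.+1 (rescale m z0 c)).
  rewrite [approx_pot N.+1 m z]/= [approx_pot N.+1 m z0]/= [approx_pot_slope _ _ _]/=.
  rewrite -mulrBr mulrCA -mulrBr; congr (_ * _).
  rewrite corner_meanB /corner_mean; cbv beta.
  have E c : rescale m z c - rescale m z0 c = (z - z0) * (contraction m)%:C^-1.
    by rewrite /rescale -mulrBl; congr (_ * _); ring.
  by rewrite !E; ring.
rewrite normcM normc_contractionV ler_pdivrMl //.
apply: corner_mean_le => b c.
have y1 := rescale_gt1 m b c z1; have y01 := rescale_gt1 m b c z01.
apply: le_trans (IH m.+1 _ _ y1 y01) _.
have f1 := rescale_far m z b c; have f2 := rescale_far m z0 b c.
have -> : rescale m z (corner b c) - rescale m z0 (corner b c) = (z - z0) * (contraction m)%:C^-1.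
  by rewrite /rescale -mulrBl; congr (_ * _); ring.
rewrite normcM normc_contractionV.
move: f1 f2 y1 y01; move: (normc (rescale _ _ _)) (normc (rescale m z0 _)) => y y0 f1 f2 y1 y01.
have -> : contraction m * (normc (z - z0) ^+ 2 / ((normc z - 1) * (normc z0 - 1) ^+ 2)) =
  (normc (z - z0) / contraction m) ^+ 2 /
   (((normc z - 1) / contraction m) * ((normc z0 - 1) / contraction m) ^+ 2).
  by field; rewrite !gt_eqF // subr_gt0.
apply: ler_wpM2l; first exact: sqr_ge0.
have p1 : 0 < (normc z - 1) / contraction m by rewrite divr_gt0 // subr_gt0.
have p2 : 0 < (normc z0 - 1) / contraction m by rewrite divr_gt0 // subr_gt0.
rewrite lef_pV2 ?posrE; last 2 first.
- by rewrite mulr_gt0 ?exprn_gt0 // subr_gt0.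
- by rewrite mulr_gt0 ?exprn_gt0.
by apply: ler_pM; rewrite ?exprn_ge0 ?ler_pXn2r ?nnegrE //; lra.
Qed.

Lemma potential_cdiff_far m z0 : 1 < normc z0 -> cdiff (potential m) z0.
Proof.
move=> z01; pose r := (normc z0 - 1) / 2; have r0 : 0 < r by rewrite /r; lra.
have near z : normc (z - z0) < r -> r < normc z - 1.
  by move=> h; have := normc_distl z0 z; rewrite normcB /r in h *; lra.
apply: (@cdiff_lim R (fun N => approx_pot N m) _ z0 (fun N => approx_pot_slope N m z0) r
  ((r * (normc z0 - 1) ^+ 2)^-1) r0) => [z _|N z zr]; first exact: potential_cvg.
have zr' := near z zr.
apply: le_trans (approx_pot_taylor _ _ _ z01) _; first by lra.
rewrite mulrC ler_wpM2r ?sqr_ge0 //.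
have p : 0 < (normc z0 - 1) ^+ 2 by rewrite exprn_gt0 // subr_gt0.
rewrite lef_pV2 ?posrE ?mulr_gt0 // ?ler_pM2r //; lra.
Qed.

Lemma cdiffD (f g : R[i] -> R[i]) z : cdiff f z -> cdiff g z -> cdiff (fun w => f w + g w) z.
Proof.
move=> /(derivable_cdiff (f : C R -> C R) (z : C R)) Hf.
move=> /(derivable_cdiff (g : C R -> C R) (z : C R)) Hg.
by apply/(derivable_cdiff ((fun w => f w + g w) : C R -> C R) (z : C R)); exact: derivableD.
Qed.

Lemma cdiffZ (k : R[i]) (f : R[i] -> R[i]) z : cdiff f z -> cdiff (fun w => k * f w) z.
Proof.
move=> /(derivable_cdiff (f : C R -> C R) (z : C R)) Hf.
apply/(derivable_cdiff ((fun w => k * f w) : C R -> C R) (z : C R)).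
by have := @derivableZ _ _ _ (f : C R -> C R) (k : C R) z 1 Hf.
Qed.

Lemma cdiff_affine (f : R[i] -> R[i]) (p k z : R[i]) : k != 0 ->
  cdiff f ((z - p) / k) -> cdiff (fun w => f ((w - p) / k)) z.
Proof.
move=> k0 [d Hd]; exists (d / k) => e e0.
have nk : 0 < normc k by rewrite normc_gt0.
have [del del0 H] := Hd (e * normc k) (mulr_gt0 e0 nk).
exists (del * normc k); first exact: mulr_gt0.
move=> w wz.
have E : (w - p) / k - (z - p) / k = (w - z) / k by field.
have := H ((w - p) / k); rewrite E normcM normcV ltr_pdivrMr // => /(_ wz).
have -> : e * normc k * (normc (w - z) / normc k) = e * normc (w - z).
  by field; rewrite gt_eqF.
by rewrite (_ : (w - z) / k * d = (w - z) * (d / k)) //; field.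
Qed.

(** Off the discs of generation n, the potential is a combination of rescaled
    potentials, each evaluated outside of its unit disc. *)
Lemma potential_cdiff n m p s z : 0 < s -> ~ cantor_cover contraction n m p s z ->
  cdiff (fun w => potential m ((w - p) / s%:C)) z.
Proof.
elim: n m p s => [|n IH] m p s s0 nc.
  have sn : s%:C != 0 by rewrite complexR_eq0 gt_eqF.
  apply: cdiff_affine => //; apply: potential_cdiff_far.
  rewrite normcM normcV normcR gtr0_norm // ltr_pdivlMr // mul1r ltNge.
  by apply/negP.
have sn : s%:C != 0 by rewrite complexR_eq0 gt_eqF.
have rn := contractionC_neq0 R m.
have E : (fun w => potential m ((w - p) / s%:C)) = (fun w => (contraction m)%:C^-1 *
   corner_mean (fun c => potential m.+1 ((w - (p + s%:C * c)) / (s * contraction m)%:C))).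
  apply/funext => w; rewrite potential_rec; congr (_ * _).
  have Ec c : rescale m ((w - p) / s%:C) c = (w - (p + s%:C * c)) / (s * contraction m)%:C.
    rewrite /rescale (_ : (s * contraction m)%:C = s%:C * (contraction m)%:C); last exact: rmorphM.
    by field; rewrite sn rn.
  by rewrite /corner_mean !Ec.
rewrite E; apply: cdiffZ; apply: cdiffZ.
have H b c : cdiff (fun w => potential m.+1 ((w - (p + s%:C * corner b c)) / (s * contraction m)%:C)) z.
  apply: IH; first by rewrite mulr_gt0 // contraction_gt0.
  by move=> Hc; apply: nc; exists b, c.
by apply: cdiffD; apply: cdiffD; exact: H.
Qed.

End PotentialLimit.

(** * Discontinuity of the capacities *)

Section Assembly.
Variable R : realType.
Implicit Types (s t : R) (z w l p : R[i]).
Local Notation contraction := (@contraction R).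
Local Notation corner := (@corner R).

(** By Bernoulli's inequality a^(-4k) is at least a multiple of k^4, which beats
    the square of 4k + 11. *)
Lemma poly_geometric_small (a : R) : 0 < a -> a < 1 ->
  forall e : R, 0 < e -> exists N, a ^+ N * ((N%:R + 11) / 11) ^+ 2 <= e.
Proof.
move=> a0 a1 e e0; pose x := a^-1 - 1.
have x0 : 0 < x by rewrite /x subr_gt0 -[X in X < _]invr1 ltf_pV2 ?posrE.
have bern (k : nat) : k%:R * x <= a^-1 ^+ k.
  have : 1 + k%:R * x <= a^-1 ^+ k.
    elim: k => [|k IH]; first by rewrite mul0r addr0 expr0.
    rewrite exprS (_ : a^-1 = 1 + x); last by rewrite /x addrC subrK.
    rewrite -natr1; have k0 : 0 <= k%:R * x by rewrite mulr_ge0 // ltW.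
    move: IH; rewrite (_ : a^-1 = 1 + x); last by rewrite /x addrC subrK.
    move: (_ ^+ k) => u h; nra.
  lra.
pose k := ((Num.truncn ((e * x ^+ 4)^-1)).+1 + 11)%N.
have ex : 0 < e * x ^+ 4 by rewrite mulr_gt0 // exprn_gt0.
have k11 : 11 <= k%:R :> R by rewrite ler_nat /k leq_addl.
have k1 : (e * x ^+ 4)^-1 <= k%:R.
  apply: ltW; apply: lt_le_trans (truncnS_gt _) _; by rewrite ler_nat /k leq_addr.
have k0 : 0 < k%:R :> R by lra.
exists (4 * k)%N.
apply: (@le_trans _ _ (a ^+ (4 * k) * k%:R ^+ 2)).
  have h0 : 0 <= ((4 * k)%:R + 11) / 11 :> R by rewrite natrM; lra.
  have h1 : ((4 * k)%:R + 11) / 11 <= k%:R :> R by rewrite natrM; lra.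
  rewrite ler_pM2l ?exprn_gt0 // !expr2; exact: ler_pM.
have b4 : (k%:R * x) ^+ 4 <= a^-1 ^+ (4 * k).
  rewrite mulnC exprM ler_pXn2r ?nnegrE //; first by rewrite mulr_ge0 // ltW.
  by rewrite exprn_ge0 // invr_ge0 ltW.
have {}b4 : a ^+ (4 * k) * (k%:R * x) ^+ 4 <= 1.
  by rewrite mulrC -ler_pdivlMr ?exprn_gt0 // div1r -exprVn.
have kx0 : 0 < k%:R ^+ 2 * x ^+ 4 by rewrite mulr_gt0 ?exprn_gt0.
rewrite -(ler_pM2r kx0); apply: (@le_trans _ _ 1).
  by apply: le_trans b4; rewrite exprMn le_eqVlt; apply/orP; left; apply/eqP; ring.
have : 1 <= k%:R * (e * x ^+ 4) by rewrite -ler_pdivrMr // div1r.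
have : k%:R * (e * x ^+ 4) <= k%:R ^+ 2 * (e * x ^+ 4).
  by rewrite ler_pM2r // expr2 ler_peMr ?ltW //; lra.
lra.
Qed.

Lemma cantor_cover_closed (q : nat -> R) N m p s :
  closed ([set z | cantor_cover q N m p s z] : set (C R)).
Proof.
elim: N m p s => [|N IH] m p s; first exact: closed_normc_ball.
rewrite (_ : [set z | _] =
   [set z | cantor_cover q N m.+1 (p + s%:C * corner false false) (s * q m) z] `|`
   [set z | cantor_cover q N m.+1 (p + s%:C * corner false true) (s * q m) z] `|`
   ([set z | cantor_cover q N m.+1 (p + s%:C * corner true false) (s * q m) z] `|`
   [set z | cantor_cover q N m.+1 (p + s%:C * corner true true) (s * q m) z])).
  by apply: closedU; apply: closedU; exact: IH.
apply/seteqP; split=> z /=.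
  by move=> [[] [[] H]]; [right; right|right; left|left; right|left; left].
by move=> [[H|H]|[H|H]]; [exists false, false|exists false, true|exists true, false|exists true, true].
Qed.

Definition cantor_dust : set (C R) := [set z | forall N, cantor_cover contraction N 0 0 1 z].

Lemma cantor_dust_compact : compact cantor_dust.
Proof.
apply: (subclosed_compact _ (@compact_normc_ball R 1)); last first.
  by move=> z /(_ 0%N) /=; rewrite subr0.
have -> : cantor_dust = \bigcap_N [set z | cantor_cover contraction N 0 0 1 z].
  by apply/seteqP; split=> z H N => [_|]; exact: H.
by apply: closed_bigI => N _; exact: cantor_cover_closed.
Qed.

Definition motion (l : C R) (w : sphere R) : sphere R :=
  if w is Some z then Some (transport 0 l z) else infty.

Lemma unit_disc_normc (l : C R) : unit_disc l <-> normc l < 1.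
Proof. by rewrite /unit_disc /= normrcE -[1]/(1%:C) ltcR. Qed.

Lemma motion_is_holomorphic : holomorphic_motion motion.
Proof.
split.
- move=> [w|] l /unit_disc_normc l1; split.
  + have mc : {for l, continuous (fun l' : C R => transport 0 l' w : C R)}.
      apply/(cvg_normc _ _ (nbhs_filter l)) => e e0.
      have e2 : 0 < e / 2 by rewrite divr_gt0.
      have [del del0 H] := cdiff_fcont (transport_cdiff 0 w l1) e2.
      apply/nbhs_normc; exists del => // x /H h; apply: le_lt_trans h _; lra.
    apply: (@continuous_comp _ _ _ (fun l' : C R => transport 0 l' w : C R)
       (Some : C R -> sphere R)) => //.
  + by apply/derivable_cdiff; exact: transport_cdiff.
  + exact: cst_continuous.
  + exact: derivable_cst.
- move=> l /unit_disc_normc l1 [z|] [w|] //= [E]; congr Some; exact: transport_inj l1 _ _ E.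
- by move=> [w|] //=; rewrite transport0.
Qed.

Lemma motion_image0 (S : set (C R)) : motion_image motion 0 S = S.
Proof.
apply/seteqP; split=> z /=.
  by move=> [_ [w Sw <-]] [<-]; rewrite transport0.
by move=> Sz; exists (Some z); [exists z|rewrite /= transport0].
Qed.

Lemma motion_image_sub l (S : set (C R)) z : motion_image motion l S z ->
  exists2 w, S w & z = transport 0 l w.
Proof. by move=> [_ [w Sw <-]] [<-]; exists w. Qed.

(** At l = -t the dilation factor is 1 - t/5 < 1, and a geometric factor beats the
    quadratic growth of 4^n l_n. *)
Lemma moved_deriv_infty t (f : sphere R -> C R) : 0 < t -> t < 1 ->
  let S := motion_image motion (- t)%:C cantor_dust in
  analytic_on (sphere_compl S) f ->
  (forall z, ~ S z -> normc (f (Some z)) <= 1) -> deriv_infty f = 0.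
Proof.
move=> t0 t1 S fan f1; pose a := 1 - t / 5.
have a0 : 0 < a by rewrite /a; lra.
have a1 : a < 1 by rewrite /a; lra.
have lt1 : normc ((- t)%:C : R[i]) <= 1 by rewrite normcR normrN gtr0_norm // ltW.
have la : stretch (- t)%:C = a%:C.
  rewrite /stretch -rmorphM -(rmorph1 (real_complex R)) -rmorphD /=.
  by congr _%:C; rewrite /a; field.
apply: (@covered_deriv_infty R (fun m => a * contraction m) S f) => //.
- by move=> m; rewrite mulr_gt0 // contraction_gt0.
- move=> m; have := contraction_le R m; have := contraction_gt0 R m; nra.
- move=> e /(poly_geometric_small a0 a1) [N HN]; exists N; apply: le_trans HN.
  rewrite big_split /= prodr_const card_ord mulrCA.
  have := prod_contraction R 0 N; rewrite add0n add0r => <-.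
  by under [X in _ <= _ * (_ * X)]eq_bigr do rewrite add0n.
- move=> N z /motion_image_sub [w Dw ->].
  have := @transport_cantor_cover R (- t)%:C a N 0 0 1 0 1 w lt1 la a0 ltr01 ltr01.
  by rewrite !mul1r !add0r; apply; exact: Dw.
Qed.

(** The Cauchy transform, normalised by the bound 606. *)
Definition witness (w : sphere R) : C R :=
  if w is Some z then (1 / 606)%:C * potential 0 z else 0.

Lemma witness_le (v : sphere R) : normc (witness v) <= 1.
Proof.
case: v => [z|]; last by rewrite [witness _]/= normc0.
rewrite [witness _]/= normcM normcR ger0_norm; last by lra.
by have := potential_bound z; lra.
Qed.

(** The constant 1/606 is the total mass of the normalised measure. *)
Lemma witness_expansion (e : R) : 0 < e -> exists M : R, forall z, M < normc z ->
  normc (z * (witness (Some z) - witness infty) - (1 / 606)%:C) <= e.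
Proof.
move=> e0; exists (2 + 8 / e) => z zM.
have e8 : 0 < 8 / e by rewrite divr_gt0.
have z2 : 2 < normc z by lra.
have z0 : z != 0 by rewrite -normc_gt0; lra.
have -> : z * (witness (Some z) - witness infty) - (1 / 606)%:C =
    (1 / 606)%:C * (z * (potential 0 z - z^-1)).
  by rewrite /= subr0; field.
rewrite !normcM normcR ger0_norm; last by lra.
have z1 : 1 < normc z by lra.
have h := potential_inv 0 z1.
have : normc z * normc (potential 0 z - z^-1) <= e.
  apply: le_trans (_ : normc z * (2 / (normc z - 1) ^+ 2) <= _).
    by apply: ler_wpM2l => //; lra.
  rewrite mulrA ler_pdivrMr; last by rewrite exprn_gt0 // subr_gt0.
  have ze : 8 <= e * normc z by rewrite mulrC -ler_pdivrMr //; lra.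
  move: ze z2; move: (normc z) => y ze z2.
  have h1 : y ^+ 2 / 4 <= (y - 1) ^+ 2 by rewrite !expr2; nra.
  have h2 : e * (y ^+ 2 / 4) <= e * (y - 1) ^+ 2 by rewrite ler_pM2l.
  have h3 : 8 * y <= e * y * y by rewrite ler_pM2r //; lra.
  by apply: le_trans h2; rewrite expr2; lra.
have : 0 <= normc z * normc (potential 0 z - z^-1) by rewrite mulr_ge0 ?normc_ge0.
lra.
Qed.

Lemma witness_deriv : deriv_infty witness = (1 / 606)%:C.
Proof. by apply: deriv_infty_eq => e; exact: witness_expansion. Qed.

Lemma witness_deriv_norm : complex.Re `|deriv_infty witness| = 1 / 606.
Proof. by rewrite witness_deriv Re_normr normcR; apply: ger0_norm; lra. Qed.

Lemma witness_analytic : analytic_on (sphere_compl cantor_dust) witness.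
Proof.
move=> [z nz|_]; last by apply: expansion_analytic_infty => e; exact: witness_expansion.
apply/analytic_at_Some.
have /existsNP [N HN] : ~ forall N, cantor_cover contraction N 0 0 1 z.
  by move=> H; apply: nz; exists z.
have := cdiffZ (1 / 606)%:C (potential_cdiff ltr01 HN).
rewrite (_ : (fun w => _ * potential 0 ((w - 0) / 1%:C)) = (fun w => witness (Some w))) //.
by apply/funext => w /=; rewrite subr0 rmorph1 divr1.
Qed.

Lemma witness_continuous : continuous witness.
Proof.
apply: continuous_sphere => [z e e0|e e0].
  exact: (fcontZ (1 / 606)%:C (@potential_fcont R 0 z)).
have [M HM] := witness_expansion e0.
exists (Num.max M (1 + (1 / 606 + e) / e)) => z; rewrite gt_max => /andP[zM ze].
have q0 : 0 < (1 / 606 + e) / e by rewrite divr_gt0; lra.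
have z0 : 0 < normc z by lra.
have h := HM z zM.
rewrite -(ler_pM2l z0) -normcM.
have := normc_distl (z * (witness (Some z) - witness infty)) (1 / 606)%:C.
rewrite (normcR (1 / 606)) ger0_norm; last by lra.
have : 1 / 606 + e <= normc z * e by rewrite -ler_pdivrMr //; lra.
lra.
Qed.

Lemma capacity_le0 t : 0 < t -> t < 1 ->
  (analytic_capacity (motion_image motion (- t)%:C cantor_dust) <= 0)%E.
Proof.
move=> t0 t1; apply: ge_ereal_sup => _ [f [[fan _] f1] <-].
rewrite (@moved_deriv_infty t f) //; first by rewrite Re_normr normc0.
move=> z nz; have := f1 (Some z); rewrite normrcE -[1]/(1%:C) lecR; apply.
by move=> [w Sw [wz]]; apply: nz; rewrite -wz.
Qed.

Lemma continuous_capacity_le0 t : 0 < t -> t < 1 ->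
  (continuous_analytic_capacity (motion_image motion (- t)%:C cantor_dust) <= 0)%E.
Proof.
move=> t0 t1; apply: ge_ereal_sup => _ [f [[_ fan] f1] <-].
rewrite (@moved_deriv_infty t f) //; first by rewrite Re_normr normc0.
by move=> z nz; have := f1 z; rewrite normrcE -[1]/(1%:C) lecR.
Qed.

Lemma capacity_gt0 : (0 < analytic_capacity cantor_dust)%E.
Proof.
apply: (@lt_le_trans _ _ (1 / 606)%:E); first by rewrite lte_fin; lra.
apply: ereal_sup_ubound; exists witness; last first.
  by rewrite witness_deriv_norm.
have wle v : `|witness v| <= 1 by rewrite normrcE -[1]/(1%:C) lecR witness_le.
by split; [split; [exact: witness_analytic|exists 1]|].
Qed.

Lemma continuous_capacity_gt0 : (0 < continuous_analytic_capacity cantor_dust)%E.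
Proof.
apply: (@lt_le_trans _ _ (1 / 606)%:E); first by rewrite lte_fin; lra.
apply: ereal_sup_ubound; exists witness; last first.
  by rewrite witness_deriv_norm.
have wle v : `|witness v| <= 1 by rewrite normrcE -[1]/(1%:C) lecR witness_le.
by split; [split; [exact: witness_continuous|exact: witness_analytic]|].
Qed.

(** The parameters -t accumulate at 0, and the positive extended reals are open. *)
Lemma discontinuous_at0 (cap : C R -> \bar R) : (0 < cap (0 : C R)%R)%E ->
  (forall t, 0 < t -> t < 1 -> (cap (- t)%:C <= 0)%E) ->
  ~ {for (0 : C R), continuous cap}.
Proof.
move=> c0 ct /(_ [set x | (0 < x)%E]).
have /[swap] /[apply] : nbhs (cap 0) [set x | (0 < x)%E].
  by apply: open_nbhs_nbhs; split => //; exact: open_ereal_gt_ereal.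
move=> /nbhs_normc [e e0 H].
pose t := Num.min (e / 2) (1 / 2).
have t0 : 0 < t by rewrite lt_min; apply/andP; split; lra.
have te : t <= e / 2 by rewrite ge_min lexx.
have t1 : t <= 1 / 2 by rewrite ge_min lexx orbT.
have tE : t < e by lra.
have := H (- t)%:C; rewrite subr0 normcR normrN gtr0_norm // => /(_ tE) /=.
by rewrite ltNge ct //; lra.
Qed.

End Assembly.

Theorem theorem1p3 (R : realType) :
  exists (E F : set (C R)) (h : C R -> sphere R -> sphere R),
    [/\ compact E, compact F, holomorphic_motion h &
        forall l : C R, unit_disc l -> h l infty = infty] /\
    ~ {for (0 : C R),
         continuous (fun l : C R => analytic_capacity (motion_image h l E))} /\
    ~ {for (0 : C R),
         continuous (fun l : C R =>
           continuous_analytic_capacity (motion_image h l F))}.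
Proof.
exists (@cantor_dust R), (@cantor_dust R), (@motion R); split.
  by split=> //; [exact: cantor_dust_compact|exact: cantor_dust_compact|exact: motion_is_holomorphic].
split; apply: discontinuous_at0; rewrite ?motion_image0.
- exact: capacity_gt0.
- exact: capacity_le0.
- exact: continuous_capacity_gt0.
- exact: continuous_capacity_le0.
Qed.
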